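(* Let $E$ and $F$ be Borel equivalence relations on standard Borel spaces $X$ and $Y$, both admitting a Borel parametrization. Then $E\cong_B F$ if and only if $\mathrm{fs}(E)=\mathrm{fs}(F)$. Moreover, if $E$ is a smooth equivalence relation on a standard Borel space that does not admit a Borel parametrization, then there exists a smooth equivalence relation $F$ on some standard Borel space such that $\mathrm{fs}(E)=\mathrm{fs}(F)$ but $E\not\cong_B F$.
   Context: Let $\mathbb{C}^+=\{1,2,3,\ldots,\aleph_0,2^{\aleph_0}\}$; every equivalence class of a Borel equivalence relation on a standard Borel space has cardinality in $\mathbb{C}^+$. For a Borel equivalence relation $E$ on a standard Borel space $X$ and $\mathfrak{m}\in\mathbb{C}^+$, let $n_{\mathfrak{m}}(E)$ be the number (cardinality) of $E$-classes of cardinality exactly $\mathfrak{m}$; the fine shape of $E$ is the sequence $\mathrm{fs}(E)=\langle n_{\mathfrak{m}}(E):\mathfrak{m}\in\mathbb{C}^+\rangle$. $E\cong_B F$ means there is a Borel bijection $h:X\to Y$ with $x\mathrel{E}y\iff h(x)\mathrel{F}h(y)$. $E$ is smooth if there are a standard Borel space $Z$ and a Borel $f:X\to Z$ with $x\mathrel{E}y\iff f(x)=f(y)$. A Borel parametrization of an equivalence relation $E$ on a standard Borel space $X$ is a Borel bijection $\phi:X\to\bigsqcup_{\mathfrak{m}\in\mathbb{C}^+}(Z_{\mathfrak{m}}\times Y_{\mathfrak{m}})$, where the $Z_{\mathfrak{m}}$ are (possibly empty) standard Borel spaces, each $Y_{\mathfrak{m}}$ is a standard Borel space of cardinality $\mathfrak{m}$,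 and for all $x,y\in X$, $x\mathrel{E}y\iff \pi_1(\phi(x))=\pi_1(\phi(y))$, with $\pi_1$ the projection to the first coordinate. *)

(* Defs.v *)
From mathcomp Require Import all_boot all_order all_algebra.
From mathcomp Require Import boolp classical_sets functions cardinality.
From mathcomp Require Import reals topology.
From mathcomp Require Import measurable_structure.

Set Implicit Arguments.
Unset Strict Implicit.
Unset Printing Implicit Defensive.

Local Open Scope classical_set_scope.
Local Open Scope card_scope.

(* Standard Borel spaces are allowed to be empty, whereas the library's
   measurableType is pointed; measurable structures are therefore handled as
   set systems over arbitrary types. *)

Definition polish (R : realType) (P : metricType R) : Prop :=
  (exists2 D : set P, countable D & dense D) /\
  (forall F : set_system P, ProperFilter F -> cauchy F -> exists l : P, F --> l).

Definition standard_borel (R : realType) (T : Type) (S : set (set T)) : Prop :=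
  exists (P : metricType R) (f : T -> P),
    [/\ polish P, bijective f & S = [set f @^-1` B | B in <<s @open P >>]].

Record stdBorelType (R : realType) : Type := StdBorelType {
  stdBorel_sort :> Type ;
  borel : set (set stdBorel_sort) ;
  borelP : standard_borel R borel }.

Definition borel_fun T U (S : set (set T)) (S' : set (set U)) (f : T -> U)
    : Prop :=
  forall B, S' B -> S (f @^-1` B).

Definition prod_borel T U (S : set (set T)) (S' : set (set U))
    : set (set (T * U)) :=
  <<s [set A `*` B | A in S & B in S'] >>.

Definition dunion_borel (I : Type) (T : I -> Type)
    (S : forall i, set (set (T i))) : set (set {i : I & T i}) :=
  [set A | forall i, S i ((fun t : T i => existT T i t) @^-1` A)].

(* The set {1, 2, 3, ..., aleph_0, 2^aleph_0} of cardinals; beware that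
   Cfin n stands for the cardinal n.+1. *)
Inductive Cplus : Type := Cfin of nat | Caleph0 | Ccontinuum.

Definition has_card (T : Type) (A : set T) (m : Cplus) : Prop :=
  match m with
  | Cfin n => A #= `I_n.+1
  | Caleph0 => A #= [set: nat]
  | Ccontinuum => A #= [set: nat -> bool]
  end.

Section Relations.
Variable R : realType.

Definition borel_equivalence (X : stdBorelType R) (E : X -> X -> Prop)
    : Prop :=
  RelationClasses.Equivalence E /\
  prod_borel (@borel R X) (@borel R X) [set p | E p.1 p.2].

Definition classes_of_card (X : stdBorelType R) (E : X -> X -> Prop)
    (m : Cplus) : set (set X) :=
  [set C | (exists x, C = [set y | E x y]) /\ has_card C m].

(* fs(E) = fs(F): equality of the cardinals n_m(E) and n_m(F) for all m. *)
Definition same_fine_shape (X Y : stdBorelType R)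
    (E : X -> X -> Prop) (F : Y -> Y -> Prop) : Prop :=
  forall m : Cplus, classes_of_card E m #= classes_of_card F m.

Definition borel_isomorphic (X Y : stdBorelType R)
    (E : X -> X -> Prop) (F : Y -> Y -> Prop) : Prop :=
  exists h : X -> Y,
    [/\ borel_fun (@borel R X) (@borel R Y) h, bijective h &
        forall x y, E x y <-> F (h x) (h y)].

Definition smooth (X : stdBorelType R) (E : X -> X -> Prop) : Prop :=
  exists (Z : stdBorelType R) (f : X -> Z),
    borel_fun (@borel R X) (@borel R Z) f /\
    forall x y, E x y <-> f x = f y.

(* The projection of the disjoint union of the Z m * Y m onto the disjoint
   union of the Z m; the index m is kept, so that points lying in distinct
   summands have distinct projections. *)
Definition dunion_pi1 (Z Y : Cplus -> stdBorelType R)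
    (p : {m : Cplus & (Z m * Y m)%type}) : {m : Cplus & Z m} :=
  existT (fun m => Z m : Type) (projT1 p) (projT2 p).1.

Definition borel_parametrization (X : stdBorelType R) (E : X -> X -> Prop)
    (Z Y : Cplus -> stdBorelType R)
    (phi : X -> {m : Cplus & (Z m * Y m)%type}) : Prop :=
  [/\ forall m, has_card [set: Y m] m,
      borel_fun (@borel R X)
        (dunion_borel (fun m => prod_borel (@borel R (Z m)) (@borel R (Y m))))
        phi,
      bijective phi &
      forall x y, E x y <-> dunion_pi1 (phi x) = dunion_pi1 (phi y)].

Definition borel_parametrizable (X : stdBorelType R) (E : X -> X -> Prop)
    : Prop :=
  exists (Z Y : Cplus -> stdBorelType R)
    (phi : X -> {m : Cplus & (Z m * Y m)%type}),
    borel_parametrization E phi.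

End Relations.

(* Main.v *)
Require Import Defs.
From HB Require Import structures.
From mathcomp Require Import all_boot all_order all_algebra.
From mathcomp Require Import boolp classical_sets functions cardinality.
From mathcomp Require Import reals topology.
From mathcomp Require Import measurable_structure.
From mathcomp Require Import lra.

(** Everything is coded in the Baire space [baire = nat -> nat], where Borel sets
    are projections of closed sets with unique witnesses; this gives Lusin
    separation, the Lusin-Souslin theorem, the perfect set theorem for analytic
    sets, the Lusin-Novikov theorem and the Borel isomorphism theorem.

    A parametrization has as many points in [Z m] as the relation has classes of
    cardinality [m], so that equality of fine shapes yields Borel isomorphisms
    between the [Z m]'s and between the [Y m]'s, hence between the relations.

    Conversely let [E] be smooth and not parametrizable.  Then it has continuum
    many classes of cardinality the continuum: otherwise there are countably many
    of them (perfect set theorem), and Lusin-Novikov parametrizes the rest.  The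
    invariant telling [E] and [F] apart is whether the quotient is standard Borel.
    If that of [E] is not, [F] puts a copy of each class [C] above every point of
    [C] (and not only once), the classes whose cardinality occurs countably often
    excepted; this makes the quotient standard without changing the fine shape,
    even though the number of countable classes may lie strictly between
    [aleph_0] and the continuum.  If the quotient of [E] is standard, [F] adds to
    [E] continuum-sized classes indexed by a non-Borel analytic set. *)

Set Implicit Arguments.
Unset Strict Implicit.
Unset Printing Implicit Defensive.

Import Order.TTheory GRing.Theory Num.Theory.
Import metricType_numDomainType.

Local Open Scope classical_set_scope.
Local Open Scope card_scope.

(** * Sigma-algebras and the Baire space *)

(** Both constructions of [F] must preserve every [n_m], and the difficulty differs with [m]. The
    points with an uncountable fibre form an analytic set, so the number of classes of size
    continuum is either countable or the continuum. Countability of a fibre is a coanalytic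
    condition, for which no such dichotomy is provable; what remains is the identity k * aleph_0 = k
    for infinite k, and it suffices because a countable class is repeated at most aleph_0 times.
    Adding continuum many classes of size continuum to [E] is harmless once their number is the
    continuum. The result has no standard quotient whatever reduction is tried: if a reduction had
    Borel range, the image of the added part would be Borel by separation, and Lusin-Souslin would
    make the analytic index set Borel. Lusin-Novikov is proved by contradiction: when the covering
    by injective pieces fails, a Cantor set can be built inside a single fibre. *)

Section SigmaAlgebra.
Variables (T : Type) (S : set (set T)).
Hypothesis SA : sigma_algebra setT S.

(** Membership in a sigma-algebra is handled through predicates: closure under connectives and
    countable quantifiers turns a proof that a set is Borel into a traversal of its definition. *)
Lemma sa_not (P : T -> Prop) : S [set x | P x] -> S [set x | ~ P x].
Proof. by case: SA => _ + _ => /[apply]; rewrite setTD. Qed.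

Lemma sa_exn (P : nat -> T -> Prop) :
  (forall n, S [set x | P n x]) -> S [set x | exists n, P n x].
Proof.
case: SA => _ _ /[apply] h; rewrite (_ : [set x | _] = \bigcup_n [set x | P n x])//.
by apply/seteqP; split => x /= [n]; exists n.
Qed.

Lemma sa_cst (P : Prop) : S [set _ | P].
Proof.
have S0 : S set0 by case: SA.
have [p|np] := pselect P; last first.
  have -> : [set _ | P] = set0 :> set T by apply/seteqP; split.
  exact: S0.
have -> : [set _ | P] = setT :> set T by apply/seteqP; split.
by case: SA => _ /(_ _ S0) + _; rewrite setTD setC0.
Qed.

Lemma sa_ex (I : countType) (P : I -> T -> Prop) :
  (forall i, S [set x | P i x]) -> S [set x | exists i, P i x].
Proof.
move=> h; pose Q n x := if unpickle n is Some i then P i x else False.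
rewrite (_ : [set x | _] = [set x | exists n, Q n x]).
  apply: sa_exn => n; rewrite /Q; case: unpickle => [i|]; first exact: h.
  exact: sa_cst.
apply/seteqP; split => x /= [i]; first by exists (pickle i); rewrite /Q pickleK.
by rewrite /Q; case: unpickle => // j; exists j.
Qed.

Lemma sa_all (I : countType) (P : I -> T -> Prop) :
  (forall i, S [set x | P i x]) -> S [set x | forall i, P i x].
Proof.
move=> h; rewrite (_ : [set x | _] = [set x | ~ exists i, ~ P i x]).
  by apply/sa_not/sa_ex => i; exact/sa_not.
apply/seteqP; split => x /=; first by move=> Px [i]; apply.
by move=> /forallNP + i => /(_ i) /contrapT.
Qed.

Lemma sa_or (P Q : T -> Prop) :
  S [set x | P x] -> S [set x | Q x] -> S [set x | P x \/ Q x].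
Proof.
move=> SP SQ; rewrite (_ : [set x | _] = [set x | exists b : bool, if b then P x else Q x]).
  by apply: sa_ex => -[].
apply/seteqP; split => x /=; first by case; [exists true|exists false].
by case=> -[]; [left|right].
Qed.

Lemma sa_and (P Q : T -> Prop) :
  S [set x | P x] -> S [set x | Q x] -> S [set x | P x /\ Q x].
Proof.
move=> SP SQ; rewrite (_ : [set x | _] = [set x | forall b : bool, if b then P x else Q x]).
  by apply: sa_all => -[].
apply/seteqP; split => x /=; first by case=> ? ? [].
by move=> h; split; [exact: (h true)|exact: (h false)].
Qed.

Lemma sa_imp (P Q : T -> Prop) :
  S [set x | P x] -> S [set x | Q x] -> S [set x | P x -> Q x].
Proof.
move=> SP SQ; rewrite (_ : [set x | _] = [set x | ~ P x \/ Q x]).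
  by apply: sa_or => //; exact: sa_not.
apply/seteqP; split => x /=; last by case.
by have [/[swap] /[apply]|] := pselect (P x); [right|left].
Qed.

Lemma sa_ext (P Q : T -> Prop) :
  (forall x, P x <-> Q x) -> S [set x | P x] -> S [set x | Q x].
Proof. by move=> PQ; congr (S _); apply/seteqP; split => x /PQ. Qed.

Lemma sa_val (I : countType) (g : T -> I) (P : I -> Prop) :
  (forall i, S [set x | g x = i]) -> S [set x | P (g x)].
Proof.
move=> h; apply: (@sa_ext (fun x => exists i, g x = i /\ P i)).
  by move=> x; split => [[i [-> //]]|]; exists (g x).
by apply: sa_ex => i; apply: sa_and => //; exact: sa_cst.
Qed.

Lemma sa_ex_countable I (A : set I) (P : I -> T -> Prop) :
  countable A -> (forall a, A a -> S [set x | P a x]) ->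
  S [set x | exists2 a, A a & P a x].
Proof.
move=> /countable_injP[h hinj] SP.
apply: (@sa_ext (fun x => exists n, exists2 a, A a /\ h a = n & P a x)).
  move=> x; split => [[n [a [Aa _] Pa]]|[a Aa Pa]]; first by exists a.
  by exists (h a), a.
apply: sa_ex => n.
have [[a [Aa ha]]|na] := pselect (exists a, A a /\ h a = n); last first.
  apply: (@sa_ext (fun=> False)) => [x|]; last exact: sa_cst.
  by split => // -[a ?]; case: na; exists a.
apply: (@sa_ext (P a)) => [x|]; last exact: SP.
split => [Pa|[b [Ab hb] Pb]]; first by exists a.
by rewrite (_ : a = b)//; apply: hinj; rewrite ?inE// ha hb.
Qed.

Lemma sa_countable (A : set T) :
  (forall x, S [set x]) -> countable A -> S A.
Proof.
move=> S1 cA; apply: (@sa_ext (fun x => exists2 a, A a & x = a) A).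
  by move=> x; split => [[a Aa ->]|Ax] //; exists x.
by apply: sa_ex_countable => // a _; exact: S1.
Qed.

End SigmaAlgebra.

Lemma sa_preimage T U (f : T -> U) (S : set (set U)) :
  sigma_algebra setT S -> sigma_algebra setT [set f @^-1` B | B in S].
Proof.
move=> SA; split.
- by exists set0; rewrite ?preimage_set0//; case: SA.
- move=> _ [B SB <-]; exists (~` B); last by rewrite setTD.
  by case: SA => _ /(_ B SB); rewrite setTD.
- move=> F FS; have /choice[G GP] : forall n, exists B, S B /\ f @^-1` B = F n.
    by move=> n; case: (FS n) => B; exists B.
  exists (\bigcup_n G n); first by case: SA => _ _; apply => n; case: (GP n).
  by rewrite preimage_bigcup; apply: eq_bigcupr => n _; case: (GP n).
Qed.

(** * Borel sets and Borel maps of the Baire space *)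

Notation baire := (nat -> nat).

Definition cylinder : set (set baire) :=
  [set A | exists n k, A = [set x | x n = k]].

Definition bor : set (set baire) := <<s cylinder >>.

Lemma bor_sa : sigma_algebra setT bor.
Proof. exact: smallest_sigma_algebra. Qed.
#[global] Hint Resolve bor_sa : core.

Lemma bor_set0 : bor set0.
Proof. exact: (sa_cst bor_sa False). Qed.

Lemma bor_setT : bor setT.
Proof. by have := sa_cst bor_sa True; congr bor; apply/seteqP. Qed.

Lemma borel_fun_comp T U V (S1 : set (set T)) (S2 : set (set U)) (S3 : set (set V)) f g :
  borel_fun S1 S2 f -> borel_fun S2 S3 g -> borel_fun S1 S3 (g \o f).
Proof. by move=> bf bg B /bg /bf. Qed.

Lemma borel_fun_gen T U (S : set (set T)) (G : set (set U)) f :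
  sigma_algebra setT S -> (forall B, G B -> S (f @^-1` B)) ->
  borel_fun S <<s G >> f.
Proof.
move=> SA h; suff : <<s G >> `<=` [set B | S (f @^-1` B)] by [].
apply: smallest_sub => //; split => //=.
- exact: (sa_cst SA False).
- by move=> A SfA; rewrite setTD; exact: sa_not.
- move=> F SF; rewrite preimage_bigcup.
  by case: SA => _ _; apply.
Qed.

Lemma borel_funN T (S : set (set T)) (f : T -> baire) :
  sigma_algebra setT S -> (forall n k, S [set x | f x n = k]) ->
  borel_fun S bor f.
Proof. by move=> SA h; apply: borel_fun_gen => // _ [n [k ->]]; exact: h. Qed.

Section BorelFunN.
Variables (T : Type) (S : set (set T)).
Hypothesis SA : sigma_algebra setT S.

Lemma bfN (f : T -> baire) n k : borel_fun S bor f -> S [set x | f x n = k].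
Proof.
by move=> /(_ [set x | x n = k]); apply; apply: sub_sigma_algebra; exists n, k.
Qed.

Lemma bf_coord (f : T -> baire) n (P : nat -> Prop) :
  borel_fun S bor f -> S [set x | P (f x n)].
Proof. by move=> bf; apply: (@sa_val _ _ SA _ (f^~ n)) => k; exact: bfN. Qed.

Lemma bf_mkseq (f : T -> baire) n (P : seq nat -> Prop) :
  borel_fun S bor f -> S [set x | P (mkseq (f x) n)].
Proof.
move=> bf; apply: (@sa_val _ _ SA _ (fun x => mkseq (f x) n)) => s.
have [<-|ns] := eqVneq (size s) n; last first.
  apply: (@sa_ext _ _ (fun=> False)) => [x|]; last exact: sa_cst.
  by split => // xs; move: ns; rewrite -xs size_mkseq eqxx.
apply: (@sa_ext _ _ (fun x => forall i, (i < size s)%N -> f x i = nth 0%N s i)).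
  move=> x; split => [h|<- i].
    apply: (@eq_from_nth _ 0%N); first by rewrite size_mkseq.
    by move=> i; rewrite size_mkseq => il; rewrite nth_mkseq// h.
  by rewrite size_mkseq => il; rewrite nth_mkseq.
by apply: sa_all => // i; apply: sa_imp => //; [exact: sa_cst|exact: bfN].
Qed.

Lemma bf_eq (f g : T -> baire) :
  borel_fun S bor f -> borel_fun S bor g -> S [set x | f x = g x].
Proof.
move=> bf bg; apply: (@sa_ext _ _ (fun x => forall n, exists k, f x n = k /\ g x n = k)).
  by move=> x; split => [h|-> n]; [apply/funext => n; case: (h n) => k [-> ->]|exists (g x n)].
by apply: sa_all => // n; apply: sa_ex => // k; apply: sa_and => //; exact: bfN.
Qed.

Lemma bf_cst (c : baire) : borel_fun S bor (fun=> c).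
Proof. by move=> B _; exact: sa_cst. Qed.

Lemma bf_reindex (f : T -> baire) (e : nat -> nat) :
  borel_fun S bor f -> borel_fun S bor (fun x n => f x (e n)).
Proof. by move=> bf; apply: borel_funN => // n k; exact: bfN. Qed.

(** Decodes a point from countably many Borel tests: when inverting an injection, [D n k] will test
    whether coordinate [n] of the preimage is [k]. Taking the least successful [k], or 0 if there is
    none, keeps the choice Borel. *)
Lemma bf_least (D : nat -> nat -> set T) : (forall n k, S (D n k)) ->
  exists b : T -> baire, borel_fun S bor b /\
    forall x n, (exists k, D n k x) -> D n (b x n) x.
Proof.
move=> SD.
have /choice[b bP] : forall x, exists y : baire, forall n,
    (D n (y n) x /\ forall j, (j < y n)%N -> ~ D n j x) \/
    (y n = 0%N /\ forall k, ~ D n k x).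
  move=> x; suff /choice[y yP] : forall n, exists yn, (D n yn x /\ forall j, (j < yn)%N -> ~ D n j x) \/
      (yn = 0%N /\ forall k, ~ D n k x) by exists y.
  move=> n.
  have [[k Dk]|/forallNP h] := pselect (exists k, D n k x).
    have ex : exists k, `[< D n k x >] by exists k; exact/asboolP.
    exists (ex_minn ex); left; case: ex_minnP => m /asboolP Dm mmin.
    by split => // j jm /asboolP /mmin; rewrite leqNgt jm.
  by exists 0%N; right.
exists b; split; last first.
  by move=> x n [k Dk]; case: (bP x n) => [[]//|[_ /(_ k)]].
apply: borel_funN => // n k.
apply: (@sa_ext _ _ (fun x => (D n k x /\ forall j, (j < k)%N -> ~ D n j x) \/
    (0%N = k /\ forall k, ~ D n k x))).
  move=> x; split => [|<-]; last by case: (bP x n) => [|[<-]]; tauto.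
  case: (bP x n) => [[D1 h1]|[-> h1]].
    move=> [[D2 h2]|[_ /(_ _ D1)//]].
    by case: (ltngtP (b x n) k) => // [/h2|/h1].
  by case=> [[/h1]|[]].
apply: sa_or => //; apply: sa_and => //.
- exact: SD.
- by apply: sa_all => // j; apply: sa_imp => //; [exact: sa_cst|apply: sa_not => //; exact: SD].
- exact: sa_cst.
- by apply: sa_all => // j; apply: sa_not => //; exact: SD.
Qed.

End BorelFunN.

Lemma bf_id : borel_fun bor bor id. Proof. by []. Qed.

(** Pairing by interleaving: both projections are reindexings of coordinates, so that Borelness and
    closedness are inherited coordinate by coordinate. *)
Definition pr0 (z : baire) : baire := fun n => z n.*2.
Definition pr1 (z : baire) : baire := fun n => z n.*2.+1.
Definition pairN (x y : baire) : baire := fun n => if odd n then y n./2 else x n./2.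

Lemma pr0_pair x y : pr0 (pairN x y) = x.
Proof. by apply/funext => n; rewrite /pr0 /pairN odd_double doubleK. Qed.

Lemma pr1_pair x y : pr1 (pairN x y) = y.
Proof. by apply/funext => n; rewrite /pr1 /pairN /= odd_double /= uphalf_double. Qed.

Lemma pair_pr z : pairN (pr0 z) (pr1 z) = z.
Proof.
apply/funext => n; rewrite /pr0 /pr1 /pairN.
by have := odd_double_half n; case: odd => <-; rewrite ?add1n ?add0n/= ?uphalf_double ?doubleK.
Qed.

Section BorelPair.
Variables (T : Type) (S : set (set T)).
Hypothesis SA : sigma_algebra setT S.

Lemma bf_pr0 f : borel_fun S bor f -> borel_fun S bor (fun x => pr0 (f x)).
Proof. exact: bf_reindex. Qed.

Lemma bf_pr1 f : borel_fun S bor f -> borel_fun S bor (fun x => pr1 (f x)).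
Proof. exact: (@bf_reindex _ _ SA f (fun n => n.*2.+1)). Qed.

Lemma bf_pair f g : borel_fun S bor f -> borel_fun S bor g ->
  borel_fun S bor (fun x => pairN (f x) (g x)).
Proof.
by move=> bf bg; apply: borel_funN => // n k; rewrite /pairN; case: odd => /=; [exact: (bfN _ _ bg)|exact: (bfN _ _ bf)].
Qed.

End BorelPair.

(** * Closed sets and their injective projections *)

Definition agr n (z z' : baire) := forall i, (i < n)%N -> z i = z' i.

(** Closedness in the product topology, with [agr n] giving the basic neighbourhoods. *)
Definition clo (F : set baire) :=
  forall z, (forall n, exists z', agr n z z' /\ F z') -> F z.

Lemma clo_all I (F : I -> set baire) :
  (forall i, clo (F i)) -> clo [set z | forall i, F i z].
Proof. by move=> h z zF i; apply: h => n; case: (zF n) => z' [? ?]; exists z'; split. Qed.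

Lemma clo_and (F G : set baire) : clo F -> clo G -> clo [set z | F z /\ G z].
Proof.
by move=> cF cG z h; split; [apply: cF|apply: cG] => n; case: (h n) => z' [? []]; exists z'.
Qed.

Lemma clo_coord n (P : nat -> Prop) : clo [set z | P (z n)].
Proof. by move=> z /(_ n.+1) [z' [/(_ n) /= -> //]]. Qed.

Lemma clo_imp n (P : nat -> Prop) F : clo F -> clo [set z | P (z n) -> F z].
Proof.
move=> cF z h Pz; apply: cF => m.
case: (h (maxn m n.+1)) => z' [zz' Fz']; exists z'; split.
  by move=> i im; apply: zz'; rewrite leq_max im.
by apply: Fz'; rewrite -zz'// leq_max ltnSn orbT.
Qed.

Lemma clo_reindex (g : baire -> baire) F :
  (forall n, exists m, forall z, g z n = z m) -> clo F -> clo (g @^-1` F).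
Proof.
move=> /choice[e ge] cF z h; apply: cF => n.
have [z' [zz' Fz']] := h (\max_(i < n) e i).+1.
exists (g z'); split => // i il; rewrite !ge; apply: zz'.
by rewrite ltnS; exact: (leq_bigmax (Ordinal il)).
Qed.

Lemma mkseq_agrP n (z z' : baire) : mkseq z n = mkseq z' n <-> agr n z z'.
Proof.
split => [h i il|h]; last by apply/eq_in_map => i; rewrite mem_iota => /h.
by rewrite -(nth_mkseq 0%N z il) h nth_mkseq.
Qed.

Lemma clo_bor F : clo F -> bor F.
Proof.
move=> cF; apply: (@sa_ext _ bor (fun z => forall n, exists z', mkseq z n = mkseq z' n /\ F z') F).
  move=> z; split => [h|Fz n]; last by exists z.
  by apply: cF => n; case: (h n) => z' [/mkseq_agrP]; exists z'.
apply: sa_all => // n.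
exact: (@bf_mkseq _ _ _ id n (fun s => exists z', s = mkseq z' n /\ F z')).
Qed.

Lemma nat_pairing : exists (c : nat * nat -> nat) (d : nat -> nat * nat),
  cancel c d /\ cancel d c.
Proof.
have /card_bijP[f [g fg gf]] := card_nat2.
exists (fun p => val (f (exist _ p (mem_setT p)))).
exists (fun n => val (g (exist _ n (mem_setT n)))).
split => x.
  by rewrite (_ : exist _ _ _ = f (exist _ x (mem_setT x))) ?fg//; exact: val_inj.
by rewrite (_ : exist _ _ _ = g (exist _ x (mem_setT x))) ?gf//; exact: val_inj.
Qed.

(* Uniqueness of the witness is what later turns Borel sets into Polish spaces;
   its price is that only disjoint unions are harmless. *)
Definition kset (B : set baire) := exists F, [/\ clo F,
  forall x, B x <-> exists y, F (pairN x y) &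
  forall x y y', F (pairN x y) -> F (pairN x y') -> y = y'].

Lemma kset_cylinder n (P : nat -> Prop) : kset [set x | P (x n)].
Proof.
(* Coordinate [n] of [x] sits at [n.*2]; the odd coordinates are those of the witness, and forcing
   them to vanish makes it unique. *)
exists [set z | P (z n.*2) /\ forall i, z i.*2.+1 = 0%N]; split.
- apply: clo_and; first exact: (@clo_coord n.*2 P).
  by apply: clo_all => i; exact: (@clo_coord i.*2.+1 (fun x => x = 0%N)).
- move=> x; split => [Px|[y [+ _]]]; last by rewrite /pairN odd_double doubleK.
  exists (fun=> 0%N); split; first by rewrite /pairN odd_double doubleK.
  by move=> i; rewrite /pairN /= odd_double.
- move=> x y y' [_ h] [_ h']; apply/funext => i; move: (h i) (h' i).
  by rewrite /pairN /= odd_double /= uphalf_double => -> ->.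
Qed.

(** The witnesses for all the [B i] are merged into one along a bijection of [nat * nat] with [nat];
    its surjectivity preserves uniqueness. *)
Lemma kset_bigcap (B : nat -> set baire) :
  (forall i, kset (B i)) -> kset [set x | forall i, B i x].
Proof.
move=> /choice[F FP]; have [c [d [cd dc]]] := nat_pairing.
pose g i z := pairN (pr0 z) (fun k => pr1 z (c (i, k))).
have gp i x y : g i (pairN x y) = pairN x (fun k => y (c (i, k))).
  by rewrite /g pr0_pair pr1_pair.
exists [set z | forall i, F i (g i z)]; split.
- apply: clo_all => i; apply: clo_reindex; last by case: (FP i).
  by move=> n; rewrite /g /pairN; case: odd; eexists.
- move=> x; split => [h|[y h] i]; last first.
    by have [_ -> _] := FP i; exists (fun k => y (c (i, k))); rewrite -gp; exact: h.
  have /choice[ys ysP] : forall i, exists y, F i (pairN x y).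
    by move=> i; have [_ <- _] := FP i.
  exists (fun m => ys (d m).1 (d m).2) => i; rewrite gp.
  by under eq_fun do rewrite cd.
- move=> x y y' h h'; apply/funext => m; rewrite -(dc m); case: (d m) => i k.
  move: (h i) (h' i); rewrite !gp => hi hi'.
  by have [_ _ /(_ _ _ _ hi hi')] := FP i; move/(congr1 (@^~ k)).
Qed.

(** The head of the witness names the index [i], its tail is a witness for [B i]; disjointness makes
    the head unique. *)
Lemma kset_bigcup (B : nat -> set baire) :
  (forall i, kset (B i)) -> (forall i j x, B i x -> B j x -> i = j) ->
  kset [set x | exists i, B i x].
Proof.
move=> /choice[F FP] dB.
pose g z := pairN (pr0 z) (fun k => pr1 z k.+1).
have gp x y : g (pairN x y) = pairN x (fun k => y k.+1).
  by rewrite /g pr0_pair pr1_pair.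
(* [z 1] is the head of [pr1 z], and [g] drops that head. *)
exists [set z | forall i, z 1%N = i -> F i (g z)]; split.
- apply: clo_all => i; apply: (@clo_imp 1%N (fun k => k = i)).
  apply: clo_reindex; last by case: (FP i).
  by move=> n; rewrite /g /pairN; case: odd; eexists.
- move=> x; split => [[i Bi]|[y /= h]]; last first.
    exists (y 0%N); have [_ -> _] := FP (y 0%N).
    by exists (fun k => y k.+1); rewrite -gp; apply: h; rewrite /pairN.
  have [_ /(_ x) [/(_ Bi) [y Fy] _] _] := FP i.
  by exists (fun k => if k is k'.+1 then y k' else i) => j; rewrite gp => <-.
- move=> x y y' h h'.
  have hi := h _ erefl; have hi' := h' _ erefl; rewrite !gp in hi hi'.
  have yy' : y 0%N = y' 0%N.
    have [_ h1 _] := FP (y 0%N); have [_ h2 _] := FP (y' 0%N).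
    by apply: (dB _ _ x); [apply/h1; eexists; exact: hi|apply/h2; eexists; exact: hi'].
  apply/funext => -[//|k].
  have [_ _ /(_ x (fun k => y k.+1) (fun k => y' k.+1)) h3] := FP (y 0%N).
  have := h3 hi; rewrite yy' => /(_ hi').
  by move/(congr1 (@^~ k)).
Qed.

(** A projection of a closed set gives no hold on its complement, so the induction carries a set
    together with its complement. *)
Lemma bor_kset B : bor B -> kset B.
Proof.
suff : bor `<=` [set B | kset B /\ kset (~` B)] by move=> /[apply] -[].
apply: smallest_sub; last first.
  move=> _ [n [k ->]]; split; first exact: (@kset_cylinder n (fun x => x = k)).
  exact: (@kset_cylinder n (fun x => x <> k)).
split.
- split; first exact: (@kset_cylinder 0%N (fun=> False)).
  by rewrite setC0; have := @kset_cylinder 0%N (fun=> True); congr kset; apply/seteqP.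
- by move=> A [kA kA']; rewrite setTD; split; rewrite ?setCK.
- move=> A kA.
  have kI (P : nat -> set baire) n : (forall i, kset (P i)) ->
      kset [set x | forall i, (i < n)%N -> P i x].
    move=> kP; rewrite (_ : [set x | _] = [set x | forall i, (if (i < n)%N then P i else setT) x]).
      apply: kset_bigcap => i; case: ifP => // _.
      by have := @kset_cylinder 0%N (fun=> True); congr kset; apply/seteqP.
    apply/seteqP; split => x h i; first by case: ifP => // /h.
    by move=> il; have := h i; rewrite il.
  split; last first.
    have := @kset_bigcap (fun i => ~` A i) (fun i => (kA i).2); congr kset.
    by rewrite setC_bigcup; apply/seteqP; split => x h i; [move=> _; exact: h|exact: h].
  (* Disjoint form of the union, [n] being the least index with [A n x]; the test on [b] writes the
     conjunction of the two conditions as a countable intersection. *)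
  rewrite (_ : \bigcup_k _ = [set x | exists n, forall b : nat,
      (if b == 0%N then A n else [set x | forall i, (i < n)%N -> (~` A i) x]) x]); last first.
    apply/seteqP; split => [x [i _ Ai]|x [n /(_ 0%N) /= An]]; last by exists n.
    have ex : exists i, `[< A i x >] by exists i; exact/asboolP.
    exists (ex_minn ex); case: ex_minnP => m /asboolP Am mmin [//|b] /= j jm /asboolP.
    by move/mmin; rewrite leqNgt jm.
  apply: kset_bigcup => [n|i j x hi hj].
    by apply: kset_bigcap => -[|b] /=; [case: (kA n)|apply: kI => i; case: (kA i)].
  have [Ai hi1] := (hi 0%N, hi 1%N); have [Aj hj1] := (hj 0%N, hj 1%N).
  by case: (ltngtP i j) => // [/hj1|/hi1].
Qed.

(* A Borel map on a Borel set becomes a coordinate projection on a closed set. *)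
Lemma image_rep B g : bor B -> borel_fun bor bor g -> exists F, [/\ clo F,
  forall z, F z -> B (pr1 (pr0 z)) /\ g (pr1 (pr0 z)) = pr0 (pr0 z),
  forall x, B x -> exists2 z, F z & pr1 (pr0 z) = x &
  forall z z', F z -> F z' -> pr1 (pr0 z) = pr1 (pr0 z') -> z = z'].
Proof.
move=> bB bg.
(* Here [w] pairs a value [g x] with [x]. A point of [F] is thus ((g x, x), witness), and applying
   [g] amounts to reading the coordinates [n.*2.*2]. *)
have [|F [cF FP Fu]] := @bor_kset [set w | B (pr1 w) /\ g (pr1 w) = pr0 w].
  apply: (sa_and bor_sa); first exact: (bf_pr1 _ bf_id bB).
  apply: (@bf_eq _ _ _ (fun w => g (pr1 w)) pr0) => //; last exact: (bf_pr0 _ bf_id).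
  exact: (borel_fun_comp (bf_pr1 bor_sa bf_id) bg).
have FP' z : F z -> B (pr1 (pr0 z)) /\ g (pr1 (pr0 z)) = pr0 (pr0 z).
  by move=> Fz; apply/FP; exists (pr1 z); rewrite pair_pr.
exists F; split => //.
- move=> x Bx; have /FP[y Fy] : B (pr1 (pairN (g x) x)) /\ g (pr1 (pairN (g x) x)) = pr0 (pairN (g x) x).
    by rewrite pr1_pair pr0_pair.
  by eexists; first exact: Fy; rewrite pr0_pair pr1_pair.
- move=> z z' Fz Fz' zz'.
  have e0 : pr0 z = pr0 z'.
    rewrite -(pair_pr (pr0 z)) -(pair_pr (pr0 z')) -zz'; congr pairN.
    by have [[_ <-] [_ <-]] := (FP' _ Fz, FP' _ Fz'); rewrite zz'.
  rewrite -(pair_pr z) -(pair_pr z') e0; congr pairN.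
  by apply: (Fu (pr0 z')); rewrite ?pair_pr// -e0 pair_pr.
Qed.

(** * Lusin separation and the Lusin-Souslin theorem *)

Definition pre (s : seq nat) (z : baire) := mkseq z (size s) = s.

Lemma pre_rcons s z : pre s z -> pre (rcons s (z (size s))) z.
Proof. by rewrite /pre size_rcons mkseqS => ->. Qed.

Lemma pre_mkseq z n : pre (mkseq z n) z.
Proof. by rewrite /pre size_mkseq. Qed.

(** If the two images cannot be separated, both cylinders can be refined forever without becoming
    separable; the branches converge to points of [F] and [G], whose distinct images are told apart
    by a single coordinate. *)
Lemma lusin_sep F G (e e' : nat -> nat) : clo F -> clo G ->
  (forall z z', F z -> G z' -> z \o e <> z' \o e') ->
  exists D, [/\ bor D, forall z, F z -> D (z \o e) & forall z, G z -> ~ D (z \o e')].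
Proof.
move=> cF cG dFG.
pose Sep s s' := exists D, [/\ bor D, forall z, F z -> pre s z -> D (z \o e) &
  forall z, G z -> pre s' z -> ~ D (z \o e')].
suff : Sep [::] [::].
  by case=> D [bD DF DG]; exists D; split => // z h; [exact: DF|exact: DG].
apply: contrapT => nS.
have step : forall p : seq nat * seq nat, exists nk : nat * nat,
    ~ Sep p.1 p.2 -> ~ Sep (rcons p.1 nk.1) (rcons p.2 nk.2).
  move=> [s s'] /=; apply: contrapT => /forallNP h.
  have {}h : ~ Sep s s' /\ forall nk, Sep (rcons s nk.1) (rcons s' nk.2).
    split; first by move=> S; apply: (h (0%N, 0%N)).
    by move=> nk; apply: contrapT => S; apply: (h nk).
  case: h => nSs /choice[D DP]; apply: nSs.
  (* The image of piece [n] of the first set lies in every [D (n, k)], while that of piece [k] of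
     the second avoids them all. *)
  exists [set a | exists n, forall k, D (n, k) a]; split.
  - by apply: sa_ex => // n; apply: sa_all => // k; case: (DP (n, k)).
  - move=> z Fz /pre_rcons sz; exists (z (size s)) => k.
    by have [_ + _] := DP (z (size s), k); apply.
  - move=> z Gz /pre_rcons sz [n /(_ (z (size s')))].
    by have [_ _] := DP (n, z (size s')); apply.
have /choice[nk nkP] := step.
pose st n := iter n (fun p => (rcons p.1 (nk p).1, rcons p.2 (nk p).2)) ([::], [::]).
pose z n := (nk (st n)).1; pose z' n := (nk (st n)).2.
have stE n : st n = (mkseq z n, mkseq z' n).
  by elim: n => // n IH; rewrite /st iterS -/(st n) /= !mkseqS -/(z n) -/(z' n) IH.
have stS n : ~ Sep (mkseq z n) (mkseq z' n).
  rewrite -[mkseq z n]/((mkseq z n, mkseq z' n).1) -{2}[mkseq z' n]/((mkseq z n, mkseq z' n).2).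
  by rewrite -stE; elim: n => //= n /nkP.
(* If a cylinder missed [F], the empty set would separate; dually the whole space for [G]. *)
have Fz : F z.
  apply: cF => n; apply: contrapT => h; apply: (stS n); exists set0; split => [|w|w _ _ []].
    exact: bor_set0.
  move=> Fw; rewrite /pre size_mkseq => /mkseq_agrP wz; apply: h.
  by exists w; split => // i il; rewrite wz.
have Gz' : G z'.
  apply: cG => m; apply: contrapT => h; apply: (stS m); exists setT; split => [|//|w Gw].
    exact: bor_setT.
  rewrite /pre size_mkseq => /mkseq_agrP wz; exfalso; apply: h.
  by exists w; split => // i il; rewrite wz.
have [j zj] : exists j, z (e j) <> z' (e' j).
  apply: contrapT => /forallNP h; apply: (dFG _ _ Fz Gz'); apply/funext => j.
  exact: contrapT (h j).
(* At this depth both prefixes decide coordinate [j] of the images. *)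
apply: (stS (maxn (e j) (e' j)).+1); exists [set a | a j = z (e j)]; split.
- exact: (bfN j (z (e j)) bf_id).
- by move=> w _; rewrite /pre size_mkseq => /mkseq_agrP; apply; rewrite ltnS leq_maxl.
- move=> w _; rewrite /pre size_mkseq => /mkseq_agrP wz /= wj; apply: zj.
  by rewrite -wj /= wz// ltnS leq_maxr.
Qed.

Lemma separation B B' g g' : bor B -> bor B' ->
  borel_fun bor bor g -> borel_fun bor bor g' ->
  (forall x x', B x -> B' x' -> g x <> g' x') ->
  exists D, [/\ bor D, forall x, B x -> D (g x) & forall x, B' x -> ~ D (g' x)].
Proof.
move=> bB bB' bg bg' d.
have [F [cF FP Fs _]] := image_rep bB bg; have [G [cG GP Gs _]] := image_rep bB' bg'.
have [|D [bD DF DG]] := @lusin_sep F G (fun n => n.*2.*2) (fun n => n.*2.*2) cF cG.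
  move=> z z' /FP[/d + gz] /GP[h gz'] => /(_ _ h).
  by rewrite gz gz'.
exists D; split => // x /[dup] Bx.
  by move=> /Fs [z Fz <-]; rewrite (FP _ Fz).2; exact: DF.
by move=> /Gs [z Gz <-]; rewrite (GP _ Gz).2; exact: DG.
Qed.

(** By injectivity the points with [x n = k] and those with [x n <> k] have disjoint images;
    separating these for all [n] and [k] yields a Borel left inverse [b], and the image consists of
    the [y] that [b] and then [g] bring back to [y] through [B]. *)
Lemma lusin_souslin B g : bor B -> borel_fun bor bor g ->
  (forall x x', B x -> B x' -> g x = g x' -> x = x') ->
  exists b, [/\ borel_fun bor bor b, forall x, B x -> b (g x) = x & bor (g @` B)].
Proof.
move=> bB bg ginj.
have /choice[D DP] : forall nk : nat * nat, exists D, [/\ bor D,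
    forall x, B x -> x nk.1 = nk.2 -> D (g x) &
    forall x, B x -> x nk.1 <> nk.2 -> ~ D (g x)].
  move=> [n k] /=.
  have [|||||D [bD h1 h2]] := @separation [set x | B x /\ x n = k] [set x | B x /\ x n <> k] g g => //.
  - by apply: (sa_and bor_sa) => //; exact: (bfN _ _ bf_id).
  - by apply: (sa_and bor_sa) => //; apply: (sa_not bor_sa); exact: (bfN _ _ bf_id).
  - by move=> x x' [Bx xn] [Bx' x'n] /(ginj _ _ Bx Bx') xx'; apply: x'n; rewrite -xx'.
  - by exists D; split => // x Bx ?; [exact: h1|exact: h2].
have [|b [bb bP]] := @bf_least _ _ bor_sa (fun n k => D (n, k)).
  by move=> n k; case: (DP (n, k)).
have bg' x : B x -> b (g x) = x.
  move=> Bx; apply/funext => n; apply: contrapT => h.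
  have [_ _ /(_ x Bx)] := DP (n, b (g x) n); apply; first by move=> /= e; exact: h.
  by apply: bP; exists (x n); have [_ + _] := DP (n, x n); apply.
exists b; split => //.
apply: (@sa_ext _ bor (fun y => B (b y) /\ g (b y) = y) (g @` B)) => [y|].
  by split => [[Bb gb]|[x Bx <-]]; [exists (b y)|rewrite bg'].
apply: (sa_and bor_sa); first exact: bb.
by apply: (@bf_eq _ _ _ (fun y => g (b y)) id) => //; exact: (borel_fun_comp bb bg).
Qed.

(** * Analytic sets *)

(* Diagonalization against all closed subsets of [baire * baire], a closed set
   being coded by the set of its finite initial segments. *)
Lemma nonborel_projection : exists D, bor D /\ ~ bor (pr0 @` D).
Proof.
pose D := [set z : baire | forall n, pr0 z (pickle (mkseq z n)) = 0%N].
exists D; split.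
  apply: (@sa_ext _ bor (fun z => forall n, exists s, mkseq z n = s /\ pr0 z (pickle s) = 0%N) D).
    by move=> z; split => h n; [case: (h n) => s [<-]|exists (mkseq z n)].
  apply: (sa_all bor_sa) => n; apply: (sa_ex bor_sa) => s; apply: (sa_and bor_sa).
    exact: (bf_mkseq bor_sa n (fun s' => s' = s) bf_id).
  exact: (bfN _ _ (bf_pr0 bor_sa bf_id)).
move=> bA.
have [F [cF FP _]] := bor_kset (sa_not bor_sa bA).
pose code m := exists z n, F z /\ pickle (mkseq z n) = m.
(* The code of [F] itself: [a0] lies in the projection of [D] exactly when some [pairN a0 y] lies in
   [F], that is, when [a0] is outside that projection. *)
pose a0 : baire := fun m => if pselect (code m) then 0%N else 1%N.
have a0F z : F z <-> forall n, a0 (pickle (mkseq z n)) = 0%N.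
  split => [Fz n|h].
    by rewrite /a0; case: pselect => // -[]; exists z, n.
  apply: cF => n; have := h n; rewrite /a0; case: pselect => // -[z' [m [Fz' /(pcan_inj pickleK) e]]] _.
  exists z'; split => //; have /(congr1 size) := e; rewrite !size_mkseq => nm.
  by have /mkseq_agrP : mkseq z n = mkseq z' n by rewrite -e nm.
have [h1 h2] := FP a0.
have [[z Dz za0]|na0] := pselect ((pr0 @` D) a0).
  apply: (h2 _); last by exists z.
  exists (pr1 z); rewrite -za0 pair_pr; apply/a0F => n.
  by rewrite -za0; exact: Dz.
have [y /a0F Fy] := h1 na0.
by apply: na0; exists (pairN a0 y); rewrite ?pr0_pair// => n; rewrite pr0_pair.
Qed.

(** * Cantor schemes and the perfect set theorem *)

Lemma preP s z : pre s z <-> forall i, (i < size s)%N -> z i = nth 0%N s i.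
Proof.
split => [<- i|h].
  by rewrite size_mkseq => il; rewrite nth_mkseq.
apply: (@eq_from_nth _ 0%N); rewrite size_mkseq// => i il.
by rewrite nth_mkseq// h.
Qed.

Lemma nth_prefix (s t : seq nat) i : prefix s t -> (i < size s)%N ->
  nth 0%N s i = nth 0%N t i.
Proof. by move=> /prefixP[r ->] il; rewrite nth_cat il. Qed.

Lemma mkseq_prefix (z : baire) s n : pre s z -> (size s <= n)%N -> prefix s (mkseq z n).
Proof.
move=> sz sn; rewrite prefixE; apply/eqP; rewrite -{2}sz /mkseq -map_take take_iota.
by rewrite (minn_idPl _).
Qed.

(** Entry [i] is read in [s_ i.+1], the first term sure to be long enough. *)
Lemma chain_limit (s_ : nat -> seq nat) :
  (forall n, prefix (s_ n) (s_ n.+1)) -> (forall n, (n <= size (s_ n))%N) ->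
  forall n, pre (s_ n) (fun i => nth 0%N (s_ i.+1) i).
Proof.
move=> pS sS.
have mono n k : prefix (s_ n) (s_ (n + k)%N).
  elim: k => [|k IH]; first by rewrite addn0 prefix_refl.
  by rewrite addnS; exact: prefix_trans IH (pS _).
move=> n; apply/preP => i il.
have [h|h] := leqP i.+1 n.
  by rewrite -(subnKC h); apply: nth_prefix (mono _ _) (sS _).
have := nth_prefix (mono n (i.+1 - n)%N) il; rewrite subnKC; last exact: ltnW.
move=> h'.
by rewrite h'.
Qed.

(** A Cantor scheme of finite sequences. Siblings have to differ at a coordinate of the form [e j],
    so that distinct branches have distinct images under [z \o e]. *)
Definition scheme (F : set baire) (e : nat -> nat) (sg : seq bool -> seq nat) :=
  [/\ forall u b, prefix (sg u) (sg (rcons u b)),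
      forall u, (size u <= size (sg u))%N,
      forall u, exists j, let s b := sg (rcons u b) in
        [/\ (e j < size (s false))%N, (e j < size (s true))%N &
            nth 0%N (s false) (e j) <> nth 0%N (s true) (e j)] &
      forall u, exists z, F z /\ pre (sg u) z].

Definition slim (sg : seq bool -> seq nat) (be : nat -> bool) : baire :=
  fun n => nth 0%N (sg (mkseq be n.+1)) n.

Lemma scheme_pre F e sg : scheme F e sg ->
  forall be n, pre (sg (mkseq be n)) (slim sg be).
Proof.
move=> [pS sS _ _] be; apply: (@chain_limit (fun n => sg (mkseq be n))).
  by move=> n; rewrite mkseqS.
by move=> n; have := sS (mkseq be n); rewrite size_mkseq.
Qed.

Lemma scheme_in F e sg : clo F -> scheme F e sg -> forall be, F (slim sg be).
Proof.
move=> cF Ssg be; have pS := scheme_pre Ssg be; case: Ssg => _ sS _ nS.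
apply: cF => n; have [z [Fz /preP hz]] := nS (mkseq be n).
exists z; split => // i il; have /preP h := pS n.
have il' : (i < size (sg (mkseq be n)))%N.
  by apply: leq_trans il _; have := sS (mkseq be n); rewrite size_mkseq.
by rewrite h// hz.
Qed.

Lemma scheme_inj F e sg : scheme F e sg ->
  forall be be', slim sg be \o e = slim sg be' \o e -> be = be'.
Proof.
move=> Ssg be be' h; apply: contrapT => nbe.
have ex : exists n, be n != be' n.
  apply: contrapT => /forallNP H; apply: nbe; apply/funext => n.
  by apply/eqP; rewrite -[_ == _]negbK; exact/negP/H.
case: (ex_minnP ex) => n nn nmin.
have E : mkseq be n = mkseq be' n.
  apply/eq_in_map => i; rewrite mem_iota add0n => /= il; apply/eqP; rewrite -[_ == _]negbK.
  by apply/negP => /nmin; rewrite leqNgt il.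
have /preP p1 := scheme_pre Ssg be n.+1; have /preP p2 := scheme_pre Ssg be' n.+1.
rewrite !mkseqS -E in p1 p2.
case: Ssg => _ _ /(_ (mkseq be n)) [j /= [j1 j2 nj]] _.
have hj : slim sg be (e j) = slim sg be' (e j) by move/(congr1 (@^~ j)): h.
move: nn p1 p2; case: (be n); case: (be' n) => // _ p1 p2; apply: nj.
  by rewrite -p1// -p2.
by rewrite -p1// -p2.
Qed.

(** Cantor-Bendixson argument: the cylinders with countable image account for countably many image
    points only, so there is, off any prescribed image, a point all of whose prefixes have
    uncountable image. Two such points with distinct images give the next splitting. *)
Lemma perfect_scheme (F : set baire) (e : nat -> nat) : ~ countable [set z \o e | z in F] ->
  exists sg, scheme F e sg.
Proof.
move=> nF.
pose big s := ~ countable [set z \o e | z in [set z : baire | F z /\ pre s z]].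
have split s : exists p : seq nat * seq nat, big s ->
    [/\ big p.1 /\ big p.2, prefix s p.1 /\ prefix s p.2,
      (size s < size p.1)%N /\ (size s < size p.2)%N &
      exists j, [/\ (e j < size p.1)%N, (e j < size p.2)%N & nth 0%N p.1 (e j) <> nth 0%N p.2 (e j)]].
  have [bs|nbs] := pselect (big s); last by exists ([::], [::]).
  pose small := \bigcup_(t in [set t | ~ big t]) [set z \o e | z in [set z : baire | F z /\ pre t z]].
  have csmall : countable small.
    apply: bigcup_countable; first exact: countableP.
    by move=> t /contrapT.
  have pts (a : baire) : exists z, [/\ F z, pre s z, z \o e <> a & forall n, big (mkseq z n)].
    apply: contrapT => h; apply: bs.
    have : countable (small `|` [set a]).
      rewrite (_ : _ `|` _ = \bigcup_(b in [set: bool]) if b then small else [set a]).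
        by apply: bigcup_countable; [exact: countableP|case].
      apply/seteqP; split => x; first by case; [exists true|exists false].
      by case=> -[] _; [left|right].
    apply: sub_countable; apply: subset_card_le => _ [z [Fz sz] <-].
    have [->|za] := pselect (z \o e = a); first by right.
    left; apply: contrapT => hz; apply: h; exists z; split => // n.
    apply: contrapT => nb; apply: hz; exists (mkseq z n) => //.
    by exists z => //; split => //; exact: pre_mkseq.
  have [z [Fz sz _ bz]] := pts (fun=> 0%N).
  have [z' [Fz' sz' zz' bz']] := pts (z \o e).
  have [j zj] : exists j, z (e j) <> z' (e j).
    apply: contrapT => /forallNP h; apply: zz'; apply/funext => j; apply/esym.
    exact: contrapT (h j).
  have [n [sn jn]] : exists n, (size s < n)%N /\ (e j < n)%N.
    by exists (maxn (size s) (e j)).+1; rewrite !ltnS leq_maxl leq_maxr.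
  exists (mkseq z n, mkseq z' n) => _ /=; split.
  - by split.
  - by split; apply: mkseq_prefix => //; exact: ltnW.
  - by rewrite !size_mkseq.
  - by exists j; rewrite !size_mkseq !nth_mkseq.
have {split} /choice[nx nxP] := split.
pose sg u := foldl (fun s (b : bool) => if b then (nx s).2 else (nx s).1) [::] u.
have sgS u b : sg (rcons u b) = if b then (nx (sg u)).2 else (nx (sg u)).1.
  by rewrite /sg foldl_rcons.
have sgb u : big (sg u).
  elim/last_ind: u => [|u b IH].
    rewrite /big /sg /= (_ : [set z | _] = F)//.
    by apply/seteqP; split => z; [case|].
  by rewrite sgS; have [[]] := nxP _ IH; case: b.
exists sg; split.
- by move=> u b; rewrite sgS; have [_ []] := nxP _ (sgb u); case: b.
- elim/last_ind => // u b IH; rewrite sgS size_rcons.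
  apply: leq_ltn_trans IH _.
  by have [_ _ []] := nxP _ (sgb u); case: b.
- move=> u; have [_ _ _ [j]] := nxP _ (sgb u).
  by exists j; rewrite /= !sgS.
- move=> u; apply: contrapT => /forallNP h; apply: (sgb u).
  rewrite (_ : [set _ | z in _] = set0); first exact: countable0.
  by rewrite -subset0 => t [z hz _]; case: (h z).
Qed.

Lemma uncountable_cantor : ~ countable [set: nat -> bool].
Proof.
move=> /countable_injP[f finj].
pose d n := `[< exists2 be, f be = n & ~~ be n >].
have [dd|dd] := boolP (d (f d)).
  by move: (dd) => /asboolP[be /finj->]; rewrite ?inE// dd.
by move/negP: (dd); apply; apply/asboolP; exists d.
Qed.

(** * The Lusin-Novikov theorem for closed sets *)

Section LusinNovikov.
Variables (F : set baire) (e : nat -> nat).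

Definition nice (K : set baire) := exists C : nat -> set baire,
  [/\ forall n, bor (C n),
      forall n z z', C n z -> C n z' -> z \o e = z' \o e -> z = z' &
      forall z, K z -> exists n, C n z].

Lemma nice_bigcup (I : countType) (K : I -> set baire) :
  (forall i, nice (K i)) -> nice [set z | exists i, K i z].
Proof.
move=> /choice[C CP].
exists (fun m => if unpickle m is Some (i, n) then C i n else set0); split.
- move=> m; case: unpickle => [[i n]|]; first by case: (CP i).
  exact: bor_set0.
- move=> m; case: unpickle => [[i n]|]; last by move=> ? ? [].
  by have [_ + _] := CP i; exact.
- move=> z [i Kz]; have [_ _ /(_ z Kz) [n Cn]] := CP i.
  by exists (pickle (i, n)); rewrite pickleK.
Qed.

(** After removal of a nice set, the images of the traces of [F] on the cylinders [s u] are enclosed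
    in Borel sets without a common point. For the single empty sequence this amounts to [F] being
    nice. *)
Definition small (L : seq (seq bool)) (s : seq bool -> seq nat) :=
  exists K B, [/\ nice K, forall u, bor (B u),
    forall u z, u \in L -> F z -> pre (s u) z -> K z \/ B u (z \o e) &
    forall a, exists2 u, u \in L & ~ B u a].

Definition upd (s : seq bool -> seq nat) u p := fun v => if v == u then p else s v.

(** With equal lengths, [p <> q] means that the two cylinders are disjoint. *)
Definition good (s p q : seq nat) := [/\ prefix s p, prefix s q,
  size p = size q, (size s < size p)%N & p <> q].

Lemma small_eqi L L' s : L =i L' -> small L s -> small L' s.
Proof.
move=> LL' [K [B [nK bB h1 h2]]]; exists K, B; split => //.
  by move=> u z; rewrite -LL'; exact: h1.
by move=> a; have [u] := h2 a; rewrite LL'; exists u.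
Qed.

(** The pairs [p], [q] are countably many, so the nice sets of all splittings can be removed at
    once. What else has to go is [C'], and [z \o e] is injective on it: two of its points with the
    same image would split [s u] and put that image into all the sets of a family with empty
    intersection. *)
Lemma small_split L s u u0 u1 : u \notin L -> u0 \notin L -> u1 \notin L -> u0 != u1 ->
  (forall p q, good (s u) p q -> small [:: u0, u1 & L] (upd (upd s u0 p) u1 q)) ->
  small (u :: L) s.
Proof.
move=> uL u0L u1L u01 h.
have /choice[KB KBP] : forall pq : seq nat * seq nat, exists KB : set baire * (seq bool -> set baire),
   good (s u) pq.1 pq.2 -> [/\ nice KB.1, forall u, bor (KB.2 u),
    forall v z, v \in [:: u0, u1 & L] -> F z -> pre (upd (upd s u0 pq.1) u1 pq.2 v) z ->
      KB.1 z \/ KB.2 v (z \o e) &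
    forall a, exists2 u, u \in [:: u0, u1 & L] & ~ KB.2 u a].
  move=> [p q] /=; have [/h [K [B]]|] := pselect (good (s u) p q); first by exists (K, B).
  by exists (set0, fun=> set0).
pose K p q := (KB (p, q)).1; pose B p q := (KB (p, q)).2.
have bB p q v : good (s u) p q -> bor (B p q v).
  by move=> g; have [_ + _ _] := KBP (p, q) g; exact.
(* [a] is admissible for [p] taken as either half of any splitting. *)
pose W p a := forall q, (good (s u) p q -> B p q u0 a) /\ (good (s u) q p -> B q p u1 a).
pose Bv v a := forall p q, good (s u) p q -> B p q v a.
pose Rest a := forall v, v \in L -> Bv v a.
have bgood p q v : bor [set a | good (s u) p q -> B p q v a].
  have [g|ng] := pselect (good (s u) p q).
    by apply: (@sa_ext _ bor (B p q v)) => [a|]; [tauto|exact: bB].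
  by apply: (@sa_ext _ bor (fun=> True)) => [a|]; [tauto|exact: sa_cst].
have bBv v : bor [set a | Bv v a].
  by apply: (sa_all bor_sa) => p; apply: (sa_all bor_sa) => q; exact: bgood.
have bW p : bor [set a | W p a].
  by apply: (sa_all bor_sa) => q; apply: (sa_and bor_sa); exact: bgood.
have bRest : bor [set a | Rest a].
  apply: (sa_all bor_sa) => v; apply: (sa_imp bor_sa) => //; exact: sa_cst.
pose C' := [set z : baire | [/\ pre (s u) z,
  forall n, (size (s u) < n)%N -> W (mkseq z n) (z \o e) & Rest (z \o e)]].
have bC' : bor C'.
  apply: (@sa_ext _ bor (fun z => pre (s u) z /\ ((forall n, exists t, mkseq z n = t /\ ((size (s u) < n)%N -> W t (z \o e))) /\
       Rest (z \o e))) C').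
    move=> z; split => [[h1 [h2 h3]]|[h1 h2 h3]].
      by split => // n sn; have [t [->]] := h2 n; apply.
    by split => //; split => // n; exists (mkseq z n); split => //; exact: h2.
  have be : borel_fun bor bor (fun z => z \o e) by exact: (bf_reindex bor_sa e bf_id).
  apply: (sa_and bor_sa); first exact: (bf_mkseq bor_sa _ (fun t => t = s u) bf_id).
  apply: (sa_and bor_sa); last exact: (be _ bRest).
  apply: (sa_all bor_sa) => n; apply: (sa_ex bor_sa) => t; apply: (sa_and bor_sa).
    exact: (bf_mkseq bor_sa _ (fun t' => t' = t) bf_id).
  apply: (sa_imp bor_sa); first exact: sa_cst.
  exact: (be _ (bW t)).
have iC' z z' : C' z -> C' z' -> z \o e = z' \o e -> z = z'.
  move=> [sz Wz Rz] [sz' Wz' Rz'] zz'; apply: contrapT => nzz'.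
  have [j zj] : exists j, z j <> z' j.
    apply: contrapT => /forallNP H; apply: nzz'; apply/funext => j; exact: contrapT (H j).
  have [n [sn jn]] : exists n, (size (s u) < n)%N /\ (j < n)%N.
    by exists (maxn (size (s u)) j).+1; rewrite !ltnS leq_maxl leq_maxr.
  have g : good (s u) (mkseq z n) (mkseq z' n).
    split; rewrite ?size_mkseq//; try by apply: mkseq_prefix => //; exact: ltnW.
    by move=> /mkseq_agrP /(_ j jn).
  have [_ _ _ /(_ (z \o e))[v]] := KBP (_, _) g.
  rewrite !inE => /or3P[/eqP->|/eqP->|vL] nB; apply: nB.
  - by have [h1 _] := Wz n sn (mkseq z' n); exact: h1.
  - by have [_ h1] := Wz' n sn (mkseq z n); rewrite zz'; exact: h1.
  - exact: Rz.
pose Kall := [set z | exists pq : seq nat * seq nat, (good (s u) pq.1 pq.2 /\ K pq.1 pq.2 z) \/ C' z].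
(* A point of [F] below [s u] and outside [Kall] satisfies all the [W] conditions, hence violates
   [Rest]; the complement of [Rest] therefore encloses the images for [u], and it has no point in
   common with all the [Bv v]. *)
exists Kall, (fun v => if v == u then [set a | ~ Rest a] else [set a | Bv v a]); split.
- apply: (@nice_bigcup _ (fun pq => [set z | (good (s u) pq.1 pq.2 /\ K pq.1 pq.2 z) \/ C' z])) => -[p q] /=.
  have [g|ng] := pselect (good (s u) p q); last first.
    exists (fun=> C'); split => // z [[//]|Cz]; by exists 0%N.
  have [[C [bC iC CK]] _ _ _] := KBP (p, q) g.
  exists (fun n => if n is n'.+1 then C n' else C'); split => [[|n]//|[|n]//|z].
    exact: iC.
  case=> [[_ /CK[n Cn]]|Cz]; [by exists n.+1|by exists 0%N].
- by move=> v; case: ifP => // _; exact: (sa_not bor_sa).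
- move=> v z; rewrite inE => /orP[/eqP->|vL] Fz sz; rewrite ?eqxx.
    have [Kz|nKz] := pselect (Kall z); first by left.
    have nK p q : good (s u) p q -> ~ K p q z.
      by move=> g Kz; apply: nKz; exists (p, q); left.
    (* [C'] is contained in [Kall] through every index, here an arbitrary one. *)
    right => /= Rz; apply: (nKz); exists ([::], [::]); right; split => // n sn q; split => g.
    + have [_ _ /(_ u0 z) H _] := KBP (_, _) g.
      have := H _ Fz; rewrite /upd !inE !eqxx (negbTE u01) => /(_ isT (pre_mkseq _ _)).
      by case=> // /(nK _ _ g).
    + have [_ _ /(_ u1 z) H _] := KBP (_, _) g.
      have := H _ Fz; rewrite /upd !inE !eqxx orbT => /(_ isT (pre_mkseq _ _)).
      by case=> // /(nK _ _ g).
  rewrite ifF; last by apply: contraNF uL => /eqP <-.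
  have [Kz|nKz] := pselect (Kall z); [by left|right => p q g].
  have [_ _ /(_ v z) H _] := KBP (_, _) g.
  have vn : (v == u0) = false /\ (v == u1) = false.
    by split; [apply: contraNF u0L|apply: contraNF u1L] => /eqP <-.
  have := H _ Fz; rewrite !inE /upd vn.1 vn.2 vL => /(_ isT sz).
  by case=> // Kz; exfalso; apply: nKz; exists (p, q); left.
- move=> a; have [Ra|nRa] := pselect (Rest a).
    by exists u; rewrite ?inE eqxx//=; apply.
  have [v nv] : exists v, ~ (v \in L -> Bv v a).
    by apply: contrapT => H; apply: nRa => v vL; apply: contrapT => nB; apply: H; exists v => /(_ vL).
  have vL : v \in L by apply: contrapT => H; apply: nv => /H.
  exists v; first by rewrite inE vL orbT.
  by rewrite ifF; [move=> H; apply: nv|apply: contraNF uL => /eqP <-].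
Qed.

Definition children (u : seq bool) := [:: rcons u false; rcons u true].

Lemma rcons_children u v b : (rcons v b \in children u) = (v == u).
Proof. by rewrite !inE !eqseq_rcons; case: b; rewrite ?andbT ?andbF ?orbF. Qed.

(** The nodes of a level are split one at a time; [dn] collects the children already created, and
    lengths keep the two levels apart. *)
Lemma big_children n todo : forall dn s, uniq todo ->
  (forall u, u \in todo -> size u = n) -> (forall v, v \in dn -> size v = n.+1) ->
  (forall u v, u \in todo -> v \in dn -> v \notin children u) ->
  ~ small (todo ++ dn) s ->
  exists s', [/\ ~ small (flatten (map children todo) ++ dn) s',
    forall v, v \in dn -> s' v = s v &
    forall u, u \in todo -> good (s u) (s' (rcons u false)) (s' (rcons u true))].
Proof.
elim: todo => [|u todo IH] dn s.
  by move=> _ _ _ _ h; exists s; split.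
move=> /= /andP[utodo uniqt] st sd dis nsmall.
pose u0 := rcons u false; pose u1 := rcons u true.
have su : size u = n by apply: st; rewrite inE eqxx.
have st' v : v \in todo -> size v = n by move=> vt; apply: st; rewrite inE vt orbT.
have nL (v : seq bool) : size v = n.+1 -> v \in todo -> False.
  by move=> sv /st' /eqP; rewrite sv gtn_eqF.
have sb b : size (rcons u b) = n.+1 by rewrite size_rcons su.
have nd b : rcons u b \notin todo ++ dn.
  rewrite mem_cat; apply/negP => /orP[|h]; first exact: nL.
  have : u \in u :: todo by rewrite inE eqxx.
  by move=> /dis /(_ h); rewrite rcons_children eqxx.
have [[p q] g nsm] : exists2 pq : seq nat * seq nat, good (s u) pq.1 pq.2 &
    ~ small [:: u0, u1 & todo ++ dn] (upd (upd s u0 pq.1) u1 pq.2).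
  apply: contrapT => h; apply: nsmall; apply: (@small_split _ s u u0 u1) => //.
  - rewrite mem_cat (negbTE utodo) /=; apply/negP => /sd /eqP.
    by rewrite su ltn_eqF.
  - exact: nd.
  - exact: nd.
  - by rewrite /u0 /u1 eqseq_rcons eqxx.
  - by move=> p q g; apply: contrapT => ns; apply: h; exists (p, q).
set s1 := upd _ _ _ in nsm.
have [|||s' [ns' s'd s'g]] := IH [:: u0, u1 & dn] s1 uniqt st'.
- move=> v; rewrite !inE => /or3P[/eqP->|/eqP->|/sd//]; exact: sb.
- move=> w v wt vud.
  have /or3P[/eqP->|/eqP->|vd] : [|| v == u0, v == u1 | v \in dn] by rewrite -!in_cons.
  + by rewrite rcons_children; apply: contraNneq utodo => ->.
  + by rewrite rcons_children; apply: contraNneq utodo => ->.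
  + by apply: dis => //; rewrite inE wt orbT.
- move=> sm; apply: nsm; apply: small_eqi sm => v.
  by rewrite !(mem_cat, inE); do !case: (_ == _); rewrite ?orbT//; case: (_ \in _).
have u0E : s' u0 = p.
  rewrite s'd ?inE ?eqxx// /s1 /upd eqxx ifF//.
  by rewrite /u0 /u1 eqseq_rcons andbF.
have u1E : s' u1 = q by rewrite s'd ?inE ?eqxx ?orbT// /s1 /upd eqxx.
exists s'; split.
- move=> sm; apply: ns'; apply: small_eqi sm => v.
  by rewrite !(mem_cat, inE); do !case: (_ == _); rewrite ?orbT//; case: (_ \in _).
- move=> v vd; rewrite s'd ?inE ?vd ?orbT// /s1 /upd.
  rewrite !ifF//.
    by apply/eqP => vu; move: (nd false); rewrite -/u0 -vu mem_cat vd orbT.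
  by apply/eqP => vu; move: (nd true); rewrite -/u1 -vu mem_cat vd orbT.
- move=> v; rewrite inE => /orP[/eqP->|vt]; first by rewrite u0E u1E.
  have := s'g v vt; rewrite /s1 /upd !ifF//.
    by apply/eqP => vu; apply: (nL v) => //; rewrite vu; exact: sb.
  by apply/eqP => vu; apply: (nL v) => //; rewrite vu; exact: sb.
Qed.

Definition level n : seq (seq bool) := [seq val t | t : n.-tuple bool].

Lemma mem_level n u : (u \in level n) = (size u == n).
Proof.
apply/mapP/eqP => [[t _ ->]|<-]; first exact: size_tuple.
by exists (in_tuple u); rewrite ?mem_enum.
Qed.

Lemma level_uniq n : uniq (level n).
Proof. by rewrite map_inj_uniq ?enum_uniq//; exact: val_inj. Qed.

Lemma level_children n : flatten (map children (level n)) =i level n.+1.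
Proof.
move=> u; rewrite mem_level; apply/flatten_mapP/eqP => [[v]|].
  by rewrite mem_level => /eqP sv; rewrite !inE => /orP[] /eqP ->; rewrite size_rcons sv.
case/lastP: u => // u b; rewrite size_rcons => -[su].
by exists u; rewrite ?mem_level ?su// rcons_children.
Qed.

(** If [F] is not nice, every node of every level can be split without the level becoming small,
    which gives a Cantor scheme in [F]. All its branches have the same image, since a coordinate at
    which two images differ would make a level small. One fibre then contains a copy of the Cantor
    space. *)
Lemma lusin_novikov_closed : clo F ->
  (forall a, countable [set z | F z /\ z \o e = a]) -> nice F.
Proof.
move=> cF cfib; apply: contrapT => nF.
have step : forall ns : nat * (seq bool -> seq nat), exists s', ~ small (level ns.1) ns.2 ->
    ~ small (level ns.1.+1) s' /\
    forall u, size u = ns.1 -> good (ns.2 u) (s' (rcons u false)) (s' (rcons u true)).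
  move=> [n s] /=; have [h|h] := pselect (small (level n) s); first by exists s.
  have [||||s' [h1 _ h2]] := @big_children n (level n) [::] s (level_uniq n) => //.
  - by move=> u; rewrite mem_level => /eqP.
  - by rewrite cats0.
  exists s' => _; split => [sm|u su]; last by apply: h2; rewrite mem_level su.
  by apply: h1; apply: small_eqi sm => u; rewrite cats0 level_children.
have /choice[G GP] := step.
pose fix st n := if n is n'.+1 then G (n', st n') else fun=> [::].
have stS n : ~ small (level n) (st n).
  elim: n => [|n IH] /=; last by have [] := GP (n, st n) IH.
  move=> [K [B [[C [bC iC CK]] bB h1 h2]]]; apply: nF; exists C; split => // z Fz.
  apply: CK; have l0 : [::] \in level 0 by rewrite mem_level.
  have [//|] := h1 [::] z l0 Fz erefl.
  by have [u] := h2 (z \o e); rewrite mem_level => /nilP -> /[apply].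
pose sg u := st (size u) u.
have sgS u : good (sg u) (sg (rcons u false)) (sg (rcons u true)).
  by rewrite /sg !size_rcons; have [_ /(_ u erefl)] := GP (size u, st (size u)) (@stS _).
(* [id] instead of [e]: the branches differ as points, while their images will coincide. *)
have Ssg : scheme F id sg.
  split.
  - by move=> u b; have [] := sgS u; case: b.
  - elim/last_ind => // u b IH; rewrite size_rcons; apply: leq_ltn_trans IH _.
    by have [_ _ h ? _] := sgS u; case: b => //; rewrite -h.
  - move=> u; have [p0 p1 pq _ ne] := sgS u.
    apply: contrapT => /forallNP h; apply: ne.
    apply: (@eq_from_nth _ 0%N) => // i il; apply: contrapT => ne.
    by apply: (h i) => /=; split => //; rewrite -pq.
  - move=> u; apply: contrapT => /forallNP h; apply: (@stS (size u)).
    (* A node without points of [F] would make its level small, its empty trace being enclosed in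
       the empty set. *)
    exists set0, (fun v => if v == u then set0 else setT); split.
    + by exists (fun=> set0); split => //; move=> n; exact: bor_set0.
    + move=> v; case: ifP => _; first exact: bor_set0.
      exact: bor_setT.
    + move=> v z _ Fz; case: ifP => [/eqP ->|_ _]; last by right.
      by move=> sz; case: (h z).
    + by move=> a; exists u; rewrite ?mem_level ?eqxx//; case.
have same be be' : slim sg be \o e = slim sg be' \o e.
  apply: contrapT => ne.
  have [j nj] : exists j, slim sg be (e j) <> slim sg be' (e j).
    by apply: contrapT => /forallNP h; apply: ne; apply/funext => j; exact: contrapT (h j).
  pose n := (e j).+1; pose u := mkseq be n; pose u' := mkseq be' n.
  have szu (v : seq bool) : size v = n -> (e j < size (sg v))%N.
    by move=> sv; have [_ /(_ v) + _ _] := Ssg; rewrite sv.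
  have pu : slim sg be (e j) = nth 0%N (sg u) (e j).
    have /preP := scheme_pre Ssg be n; apply; apply: szu; exact: size_mkseq.
  have pu' : slim sg be' (e j) = nth 0%N (sg u') (e j).
    have /preP := scheme_pre Ssg be' n; apply; apply: szu; exact: size_mkseq.
  have uu' : u' <> u by move=> h; apply: nj; rewrite pu pu' h.
  pose Bj c := [set a : baire | a j = c].
  have bBj c : bor (Bj c) by exact: (bfN j c bf_id).
  apply: (@stS n).
  (* The sets of sequences with the one and with the other value at [j] are disjoint and enclose the
     images of the nodes [u] and [u']. *)
  exists set0, (fun v => if v == u then Bj (slim sg be (e j)) else
                 if v == u' then Bj (slim sg be' (e j)) else setT); split.
  + by exists (fun=> set0); split => //; move=> ?; exact: bor_set0.
  + move=> v; case: ifP => _ //; case: ifP => _ //.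
    exact: bor_setT.
  + move=> v z; rewrite mem_level => /eqP sv _.
    have -> : st n v = sg v by rewrite /sg sv.
    move=> /preP /(_ _ (szu v sv)) zj.
    right; case: ifP => [/eqP vu|_]; first by rewrite /Bj /= zj pu vu.
    by case: ifP => [/eqP vu|//]; rewrite /Bj /= zj pu' vu.
  + move=> a; have [h|h] := pselect (a j = slim sg be (e j)).
      exists u'; first by rewrite mem_level size_mkseq.
      rewrite ifF; last exact/eqP.
      by rewrite eqxx /Bj /= => h'; apply: nj; rewrite -h -h'.
    by exists u; [rewrite mem_level size_mkseq|rewrite eqxx].
apply: uncountable_cantor.
pose be0 : nat -> bool := fun=> false.
have := cfib (slim sg be0 \o e); apply: sub_countable.
apply: (@card_le_trans _ _ _ (slim sg @` setT)).
  have : slim sg @` setT #= [set: nat -> bool].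
    apply: inj_card_eq => be be' _ _ h; apply: (scheme_inj Ssg).
    by rewrite h.
  by rewrite card_eq_le => /andP[].
apply: subset_card_le => _ [be _ <-]; split; [exact: scheme_in Ssg _|exact: same].
Qed.

End LusinNovikov.

(** * Comparison of cardinals, and passage from closed to Borel sets *)

Lemma card_le_inj T U (A : set T) (B : set U) (f : T -> U) :
  (forall x, A x -> B (f x)) -> (forall x y, A x -> A y -> f x = f y -> x = y) ->
  A #<= B.
Proof.
move=> fAB finj; have /injfunPex[g] : exists2 f : T -> U, set_fun A B f & set_inj A f.
  by exists f => // x y; rewrite !inE; exact: finj.
exact: inj_card_le g.
Qed.

Lemma card_eq_bij T U (A : set T) (B : set U) (f : T -> U) :
  (forall x, A x -> B (f x)) -> (forall x y, A x -> A y -> f x = f y -> x = y) ->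
  (forall y, B y -> exists2 x, A x & f x = y) -> A #= B.
Proof.
move=> fAB finj fsurj; have /bijPex[g] : exists f : T -> U, set_bij A B f.
  exists f; split => //; first by move=> x y; rewrite !inE; exact: finj.
exact: pcard_eq g.
Qed.

Lemma card_le_fun T U (u0 : U) (A : set T) (B : set U) : A #<= B ->
  exists f : T -> U, (forall x, A x -> B (f x)) /\
    (forall x y, A x -> A y -> f x = f y -> x = y).
Proof.
move=> /card_leP[f].
exists (fun x => if pselect (A x) is left Ax then val (f (exist _ x (mem_set Ax))) else u0).
split => [x Ax|x y Ax Ay]; case: pselect => // ?; first by rewrite -in_setE; exact: valP.
case: pselect => // ? /val_inj /inj; rewrite !inE => /(_ I I) h.
exact: (congr1 val h).
Qed.

(** The characteristic function of the graph of [al]. *)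
Definition bits (al : baire) : nat -> bool :=
  fun m => if unpickle m is Some (n, k) then al n == k else false.

Lemma bits_inj : injective bits.
Proof.
move=> al al' h; apply/funext => n; apply/eqP.
by have := congr1 (@^~ (pickle (n, al' n))) h; rewrite /bits pickleK eqxx.
Qed.

Lemma card_baire : [set: baire] #= [set: nat -> bool].
Proof.
rewrite card_eq_le; apply/andP; split.
  by apply: (@card_le_inj _ _ _ _ bits) => // x y _ _ /bits_inj.
apply: (@card_le_inj _ _ _ _ (fun be n => nat_of_bool (be n))) => // x y _ _ h.
by apply/funext => n; have := congr1 (@^~ n) h; case: (x n); case: (y n).
Qed.

Lemma bf_bits (f : seq bool -> nat) m k : bor [set al | f (mkseq (bits al) m) = k].
Proof.
apply: (@sa_val _ _ bor_sa _ (fun al => mkseq (bits al) m) (fun s => f s = k)) => s.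
have [<-|ns] := eqVneq (size s) m; last first.
  apply: (@sa_ext _ bor (fun=> False)) => [x|]; last exact: sa_cst.
  by split => // xs; move: ns; rewrite -xs size_mkseq eqxx.
apply: (@sa_ext _ bor (fun x => forall i, (i < size s)%N -> bits x i = nth false s i)).
  move=> x; split => [h|<- i].
    apply: (@eq_from_nth _ false); first by rewrite size_mkseq.
    by move=> i; rewrite size_mkseq => il; rewrite nth_mkseq// h.
  by rewrite size_mkseq => il; rewrite nth_mkseq.
apply: (sa_all bor_sa) => i; apply: (sa_imp bor_sa); first exact: sa_cst.
rewrite /bits; case: unpickle => [[n j]|]; last exact: sa_cst.
exact: (bf_coord bor_sa n (fun x => (x == j) = nth false s i) bf_id).
Qed.

Lemma perfect_borel B g : bor B -> borel_fun bor bor g -> ~ countable (g @` B) ->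
  exists c : baire -> baire, [/\ borel_fun bor bor c, forall al, B (c al) &
    injective (g \o c)].
Proof.
move=> bB bg nc; have [F [cF FP Fs _]] := image_rep bB bg.
pose e n := n.*2.*2.
have [|sg Ssg] := @perfect_scheme F e.
  apply: contra_not nc; congr countable; apply/seteqP; split => [_ [z Fz <-]|_ [x Bx <-]].
    by have [Bz gz] := FP _ Fz; exists (pr1 (pr0 z)) => //; rewrite gz.
  have [z Fz <-] := Fs x Bx; exists z => //.
  by have [_ ->] := FP _ Fz.
pose c0 al := slim sg (bits al).
have bc0 : borel_fun bor bor c0.
  apply: borel_funN => // n k.
  exact: (bf_bits (fun s => nth 0%N (sg s) n)).
exists (fun al => pr1 (pr0 (c0 al))); split.
- by apply: bf_pr1 => //; exact: bf_pr0.
- by move=> al; have [] := FP _ (scheme_in cF Ssg (bits al)).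
- move=> al al' /=; have [_ ->] := FP _ (scheme_in cF Ssg (bits al)).
  have [_ ->] := FP _ (scheme_in cF Ssg (bits al')).
  by move=> h; apply: bits_inj; apply: (scheme_inj Ssg).
Qed.

Lemma lusin_novikov B g : bor B -> borel_fun bor bor g ->
  (forall a, countable [set x | B x /\ g x = a]) ->
  exists C : nat -> set baire, [/\ forall n, bor (C n),
    forall n x x', C n x -> C n x' -> g x = g x' -> x = x' &
    forall x, B x <-> exists n, C n x].
Proof.
move=> bB bg cg; have [F [cF FP Fs Fi]] := image_rep bB bg.
pose e n := n.*2.*2.
have [|C [bC iC CF]] := @lusin_novikov_closed F e cF.
  move=> a; apply: sub_countable (cg a).
  apply: (@card_le_inj _ _ _ _ (fun z => pr1 (pr0 z))) => [z [Fz <-]|z z' [Fz _] [Fz' _]].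
    by have [Bz gz] := FP _ Fz; split.
  exact: Fi.
(* A Borel inverse of the bijection from [F] onto [B], along which the cover of [F] is carried over
   to [B]. *)
have [||b [bb bP _]] := @lusin_souslin F (fun z => pr1 (pr0 z)) (clo_bor cF).
- by apply: bf_pr1 => //; exact: (bf_pr0 bor_sa bf_id).
- exact: Fi.
have bx x : B x -> F (b x) /\ pr1 (pr0 (b x)) = x.
  by move=> /Fs[z Fz <-]; rewrite bP.
have be x : B x -> b x \o e = g x.
  by move=> /bx[Fb E]; have [_] := FP _ Fb; rewrite E => ->.
exists (fun n => [set x | B x /\ C n (b x)]); split => [n|n x x' [Bx Cx] [Bx' Cx'] gg|x].
- by apply: (sa_and bor_sa) => //; exact: (bb _ (bC n)).
- have [[_ <-] [_ <-]] := (bx _ Bx, bx _ Bx').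
  by rewrite (iC n _ _ Cx Cx')// !be.
- split => [Bx|[n []]//]; have [Fb _] := bx _ Bx.
  by have [n Cn] := CF _ Fb; exists n.
Qed.

(* The set of points with uncountable fibre is the projection of the Borel set
   of codes of Cantor schemes contained in a fibre. *)
Lemma uncountable_fibres B g : bor B -> borel_fun bor bor g ->
  ~ countable [set a | ~ countable [set x | B x /\ g x = a]] ->
  [set: nat -> bool] #<= [set a | ~ countable [set x | B x /\ g x = a]].
Proof.
move=> bB bg; have [F [cF FP Fs Fi]] := image_rep bB bg.
pose e n := n.*2.*2.
have fibE a : countable [set x | B x /\ g x = a] <-> countable [set z | F z /\ z \o e = a].
  split; apply: sub_countable.
    apply: (@card_le_inj _ _ _ _ (fun z => pr1 (pr0 z))) => [z [Fz <-]|z z' [Fz _] [Fz' _]].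
      by have [Bz gz] := FP _ Fz; split.
    exact: Fi.
  have /choice[h hP] : forall x, exists z, B x -> F z /\ pr1 (pr0 z) = x.
    move=> x; have [/Fs[z Fz zx]|nB] := pselect (B x); first by exists z.
    by exists x.
  apply: (@card_le_inj _ _ _ _ h) => [x [Bx <-]|x y [Bx _] [By _] xy].
    by have [Fh hx] := hP x Bx; split => //; have [_] := FP _ Fh; rewrite hx => ->.
  by have [[_ <-] [_ <-]] := (hP x Bx, hP y By); rewrite xy.
(* [w] read as a map from binary to finite sequences, hence as the code of a possible scheme. *)
pose sg (w : baire) (u : seq bool) : seq nat := odflt [::] (unpickle (w (pickle u))).
pose Fa a := [set z | F z /\ z \o e = a].
(* The second clause forces all branches of the scheme into the fibre above [pr0 q]. *)
pose Q := [set q | scheme F id (sg (pr1 q)) /\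
  forall u j, (e j < size (sg (pr1 q) u))%N -> nth 0%N (sg (pr1 q) u) (e j) = pr0 q j].
have QU q : Q q -> ~ countable (Fa (pr0 q)).
  move=> [Sq Qe]; have qs be : Fa (pr0 q) (slim (sg (pr1 q)) be).
    split; first exact: scheme_in Sq be.
    apply/funext => j; have /preP := scheme_pre Sq be (e j).+1.
    have [_ /(_ (mkseq be (e j).+1)) + _ _] := Sq; rewrite size_mkseq => sj.
    by move=> /(_ _ sj) /= ->; exact: Qe.
  apply: contra_not uncountable_cantor; apply: sub_countable.
  apply: (@card_le_inj _ _ _ _ (slim (sg (pr1 q)))) => // x y _ _ xy.
  by apply: (scheme_inj Sq); rewrite xy.
have UQ a : ~ countable (Fa a) -> exists2 q, Q q & pr0 q = a.
  move=> nF; have [|s [h1 h2 h3 h4]] := @perfect_scheme (Fa a) id.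
    apply: contra_not nF; congr countable; apply/seteqP.
    by split => [_ [z Fz <-]//|z Fz]; exists z.
  pose w m := if unpickle m is Some u then pickle (s u) else 0%N.
  have sw u : sg w u = s u by rewrite /sg /w !pickleK.
  exists (pairN a w); rewrite ?pr0_pair//; rewrite /Q /= pr0_pair pr1_pair.
  rewrite (_ : sg w = s); last by apply/funext.
  split; first by split => // u; have [z [[Fz _] uz]] := h4 u; exists z.
  move=> u j uj; have [z [[_ <-] /preP uz]] := h4 u.
  by rewrite /= uz.
have bQ : bor Q.
  have bw : borel_fun bor bor pr1 by exact: (bf_pr1 bor_sa bf_id).
  have b0 : borel_fun bor bor pr0 by exact: (bf_pr0 bor_sa bf_id).
  have bs1 (P : seq nat -> Prop) u : bor [set q | P (sg (pr1 q) u)].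
    exact: (bf_coord bor_sa _ (fun k => P (odflt [::] (unpickle k))) bw).
  have bs2 (P : seq nat -> seq nat -> Prop) u v : bor [set q | P (sg (pr1 q) u) (sg (pr1 q) v)].
    apply: (@sa_ext _ bor (fun q => exists s, sg (pr1 q) u = s /\ P s (sg (pr1 q) v))).
      by move=> q; split => [[s [->]]//|h]; exists (sg (pr1 q) u).
    apply: (sa_ex bor_sa) => s; apply: (sa_and bor_sa).
      exact: (bs1 (fun x => x = s)).
    exact: (bs1 (P s)).
  apply: (@sa_ext _ bor (fun q => (((forall u b, prefix (sg (pr1 q) u) (sg (pr1 q) (rcons u b))) /\
     (forall u, (size u <= size (sg (pr1 q) u))%N)) /\
     ((forall u, (fun s s' => exists j, [/\ (j < size s)%N, (j < size s')%N & nth 0%N s j <> nth 0%N s' j])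
         (sg (pr1 q) (rcons u false)) (sg (pr1 q) (rcons u true))) /\
      (forall u, exists z, F z /\ pre (sg (pr1 q) u) z))) /\
      forall u j, exists k, pr0 q j = k /\ ((e j < size (sg (pr1 q) u))%N -> nth 0%N (sg (pr1 q) u) (e j) = k)) Q).
    move=> q; split.
      move=> [[[h1 h2] [h3 h4]] h5]; split; first by split.
      by move=> u j uj; have [k [->]] := h5 u j; apply.
    move=> [[h1 h2 h3 h4] h5]; split; first by split.
    by move=> u j; exists (pr0 q j); split => //; exact: h5.
  apply: (sa_and bor_sa); first (apply: (sa_and bor_sa); apply: (sa_and bor_sa)).
  - apply: (sa_all bor_sa) => u; apply: (sa_all bor_sa) => b.
    exact: (bs2 (fun s s' => prefix s s')).
  - by apply: (sa_all bor_sa) => u; exact: (bs1 (fun s => size u <= size s)%N).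
  - by apply: (sa_all bor_sa) => u; exact: (bs2 (fun s s' => exists j, [/\ (j < size s)%N, (j < size s')%N & nth 0%N s j <> nth 0%N s' j])).
  - by apply: (sa_all bor_sa) => u; exact: (bs1 (fun s => exists z, F z /\ pre s z)).
  - apply: (sa_all bor_sa) => u; apply: (sa_all bor_sa) => j; apply: (sa_ex bor_sa) => k.
    apply: (sa_and bor_sa); first exact: (bfN _ _ b0).
    exact: (bs1 (fun s => (e j < size s)%N -> nth 0%N s (e j) = k)).
have UE : [set a | ~ countable [set x | B x /\ g x = a]] = pr0 @` Q.
  apply/seteqP; split => [a /= /(contra_not (fibE a).2)/UQ[q]|_ [q Qq <-] /=].
    by exists q.
  by move=> /fibE; exact: QU.
rewrite UE => /(perfect_borel bQ (bf_pr0 bor_sa bf_id)) [c [bc cQ ci]].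
rewrite -(card_le_eql card_baire).
by apply: (@card_le_inj _ _ _ _ (pr0 \o c)) => [x _|x y _ _ /ci//]; exists (c x).
Qed.

(** * Standard Borel spaces *)

Lemma sig_inj T (B : set T) (x y : {x | B x}) : sval x = sval y -> x = y.
Proof. by case: x y => x Fx [y Fy] /= xy; subst y; congr exist; exact: Prop_irrelevance. Qed.

Definition embeds T (S : set (set T)) (i : T -> baire) :=
  [/\ injective i, bor (range i) & S = [set i @^-1` B | B in bor]].

(* Equivalent to [standard_borel R S] for every [R]. *)
Definition sborel T (S : set (set T)) := exists i, embeds S i.

Lemma sborel_sa T (S : set (set T)) : sborel S -> sigma_algebra setT S.
Proof. by move=> [i [_ _ ->]]; exact: sa_preimage. Qed.

(** * Polish spaces as Borel subsets of the Baire space *)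

Section PolishEmbedding.
Variables (R : realType) (P : metricType R).
Local Open Scope ring_scope.
Hypothesis polishP : polish P.
Variable p0 : P.

Let r (k : nat) : R := k.+1%:R^-1.

Let r_gt0 k : 0 < r k. Proof. by rewrite invr_gt0 ltr0Sn. Qed.

Let r_small (x : R) : 0 < x -> exists k, r k < x.
Proof. by move=> /ltr_add_invr[k]; rewrite add0r; exists k. Qed.

Let r_le k l : (k <= l)%N -> r l <= r k.
Proof. by move=> kl; rewrite lef_pV2 ?posrE ?ltr0Sn// ler_nat. Qed.

Lemma polish_dense_seq : exists d : nat -> P, forall x (q : R), 0 < q -> exists n, mdist x (d n) < q.
Proof.
have [[D /countable_injP[h hinj] dD] _] := polishP.
have /choice[d dP] : forall n, exists y, (exists2 x, D x & h x = n) -> D y /\ h y = n.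
  move=> n; have [[x Dx hx]|nx] := pselect (exists2 x, D x & h x = n); first by exists x.
  by exists p0.
exists d => x q q0.
have [y [/= xy Dy]] : (ball x q)° `&` D !=set0.
  apply: dD; last exact: open_interior.
  by exists x; apply: nbhs_singleton; apply: nbhs_interior; exact: nbhsx_ballx.
exists (h y); have [|Dd hd] := dP (h y); first by exists y.
have -> : d (h y) = y by apply: hinj; rewrite ?inE.
by have := interior_subset xy; rewrite ballEmdist.
Qed.

Lemma open_mdist (y : P) (q : R) : open [set x | mdist x y < q].
Proof.
rewrite openE => x /= xy; apply/nbhs_ballP; exists (q - mdist x y) => /=.
  by rewrite subr_gt0.
move=> z; rewrite ballEmdist /= => xz.
have := metric_triangle z x y; rewrite (metric_sym z x); lra.
Qed.

(** [io x k] is the index of the first point of a dense sequence at distance less than 1/(k+1) from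
    [x]. The image is Borel because the distances from the limit of a sequence in [K] to the points
    [d j] can be bounded without naming the limit. *)
Lemma polish_embedding : exists (io : P -> baire),
  [/\ injective io, bor (range io),
      borel_fun <<s @open P >> bor io &
      forall U, <<s @open P >> U -> exists2 B, bor B & io @^-1` B = U].
Proof.
have [d dP] := polish_dense_seq.
have /choice[io ioP] : forall x, exists al : baire, forall k,
    mdist x (d (al k)) < r k /\ forall j, (j < al k)%N -> ~ mdist x (d j) < r k.
  move=> x; suff /choice[al alP] : forall k, exists n,
    mdist x (d n) < r k /\ forall j, (j < n)%N -> ~ mdist x (d j) < r k by exists al.
  move=> k; case: (ex_minnP (dP x _ (r_gt0 k))) => n xn nmin; exists n; split => // j jn xj.
  by have := nmin _ xj; rewrite leqNgt jn.
have ioE x (al : baire) : (forall k, mdist x (d (al k)) < r k /\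
    forall j, (j < al k)%N -> ~ mdist x (d j) < r k) -> io x = al.
  move=> h; apply/funext => k; have [h1 h2] := h k; have [i1 i2] := ioP x k.
  by case: (ltngtP (io x k) (al k)) => // [/h2|/i2].
(* By the triangle inequality the image lies in [K], and this condition makes the sequence
   Cauchy. *)
pose K := [set al : baire | forall k l, mdist (d (al k)) (d (al l)) < r k + r l].
have Kio x : K (io x).
  move=> k l; have [h1 _] := ioP x k; have [h2 _] := ioP x l.
  have := metric_triangle (d (io x k)) x (d (io x l)); rewrite (metric_sym _ x); lra.
have lim al : K al -> exists x, forall k, mdist x (d (al k)) <= r k.
  move=> Kal; have [_ /(_ ((fun k => d (al k)) @ \oo))] := polishP.
  case; [|move=> x cx].
    apply/cauchyP => q q0; have [n rn] := r_small (divr_gt0 q0 (ltr0Sn _ 1)).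
    exists (d (al n)); exists n => // m /= nm; rewrite ballEmdist /=.
    have := Kal n m; have := r_le nm; lra.
  exists x => k; apply/ler_addgt0Pl => q q0.
  have q2 : 0 < q / 2 by rewrite divr_gt0.
  have [n rn] := r_small q2.
  have /fcvgrPdist_lt /(_ _ q2) [m _ hm] := cx.
  have := hm (maxn m n) (leq_maxl _ _); have := r_le (leq_maxr m n).
  have := Kal (maxn m n) k; rewrite /=.
  have := metric_triangle x (d (al (maxn m n))) (d (al k)); lra.
have /choice[la laP] : forall al, exists x, K al -> forall k, mdist x (d (al k)) <= r k.
  move=> al; have [/lim[x]|] := pselect (K al); first by exists x.
  by exists p0.
have lio x : la (io x) = x.
  apply: mdist_positivity; apply/eqP; rewrite eq_le mdist_ge0 andbT.
  apply/ler_addgt0Pl => q q0; rewrite addr0.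
  have [n rn] := r_small (divr_gt0 q0 (ltr0Sn _ 1)).
  have := laP _ (Kio x) n; have [] := ioP x n; move=> + _.
  have := metric_triangle (la (io x)) (d (io x n)) x; rewrite (metric_sym (d (io x n)) x); lra.
have io_inj : injective io by exact: can_inj lio.
(* Says that the limit of [al] is within [q] of [d j] by a condition on single coordinates of
   [al]. *)
pose G j q (al : baire) := exists m, mdist (d (al m)) (d j) + r m < q.
have GP al j q : K al -> G j q al <-> mdist (la al) (d j) < q.
  move=> Kal; split => [[m]|h].
    have := laP _ Kal m; have := metric_triangle (la al) (d (al m)) (d j); lra.
  have q2 : 0 < (q - mdist (la al) (d j)) / 2 by rewrite divr_gt0// subr_gt0.
  have [m rm] := r_small q2; exists m.
  have := laP _ Kal m; have := metric_triangle (d (al m)) (la al) (d j).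
  by rewrite (metric_sym (d (al m)) (la al)); lra.
have bG j q : bor [set al | G j q al].
  apply: (sa_ex bor_sa) => m.
  exact: (bf_coord bor_sa m (fun n => mdist (d n) (d j) + r m < q) bf_id).
have bK : bor K.
  apply: (@sa_ext _ bor (fun al => forall k l, exists n, al k = n /\ mdist (d n) (d (al l)) < r k + r l) K).
    by move=> al; split => h k l; [have [n [->]] := h k l|exists (al k)].
  apply: (sa_all bor_sa) => k; apply: (sa_all bor_sa) => l; apply: (sa_ex bor_sa) => n.
  apply: (sa_and bor_sa); first exact: (bfN _ _ bf_id).
  exact: (bf_coord bor_sa l (fun m => mdist (d n) (d m) < r k + r l) bf_id).
have opS : sigma_algebra setT <<s @open P >> by exact: smallest_sigma_algebra.
exists io; split => //.
- apply: (@sa_ext _ bor (fun al => K al /\ forall k, exists n, al k = n /\ (G n (r k) al /\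
      forall j, (j < n)%N -> ~ G j (r k) al)) (range io)).
    move=> al; split => [[Kal h]|[x _ <-]].
      exists (la al) => //; apply: ioE => k; have [n [-> [h1 h2]]] := h k.
      by split => [|j /h2 +]; [exact/(GP _ _ _ Kal)|move=> + /(GP _ _ _ Kal)].
    split; first exact: Kio.
    move=> k; exists (io x k); split => //; have [h1 h2] := ioP x k.
    split; first by apply/(GP _ _ _ (Kio x)); rewrite lio.
    by move=> j /h2 + /(GP _ _ _ (Kio x)); rewrite lio.
  apply: (sa_and bor_sa) => //; apply: (sa_all bor_sa) => k; apply: (sa_ex bor_sa) => n.
  apply: (sa_and bor_sa); first exact: (bfN _ _ bf_id).
  apply: (sa_and bor_sa); first exact: bG.
  apply: (sa_all bor_sa) => j; apply: (sa_imp bor_sa); first exact: sa_cst.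
  exact: (sa_not bor_sa (bG _ _)).
- apply: borel_funN => // k n.
  apply: (@sa_ext _ <<s @open P >> (fun x => mdist x (d n) < r k /\ forall j, (j < n)%N -> ~ mdist x (d j) < r k)).
    move=> x; split => [[h1 h2]|<-]; last exact: ioP.
    have [i1 i2] := ioP x k.
    by case: (ltngtP (io x k) n) => // [/h2|/i2].
  apply: (sa_and opS); first by apply: sub_sigma_algebra; exact: open_mdist.
  apply: (sa_all opS) => j; apply: (sa_imp opS); first exact: sa_cst.
  by apply: (sa_not opS); apply: sub_sigma_algebra; exact: open_mdist.
- pose S' := [set io @^-1` B | B in bor].
  have S'sa : sigma_algebra setT S' by exact: sa_preimage.
  suff : <<s @open P >> `<=` S' by move=> + U UU => /(_ U UU) [B]; exists B.
  apply: smallest_sub => // U oU.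
  apply: (@sa_ext _ S' (fun x => exists jk : nat * nat, ([set y | mdist y (d jk.1) < r jk.2] `<=` U) /\ mdist x (d jk.1) < r jk.2) U).
    move=> x; split => [[[j k] [h xj]]|Ux]; first exact: h.
    move: oU; rewrite openE => /(_ x Ux) /nbhs_ballP[q /= q0 qU].
    have [k rk] := r_small (divr_gt0 q0 (ltr0Sn _ 1)).
    have [j xj] := dP x _ (r_gt0 k).
    exists (j, k); split => //= y /= yj; apply: qU; rewrite ballEmdist /=.
    have := metric_triangle x (d j) y; rewrite (metric_sym (d j) y); lra.
  apply: (sa_ex S'sa) => -[j k] /=; apply: (sa_and S'sa); first exact: sa_cst.
  exists [set al | G j (r k) al] => //; apply/seteqP; split => x /=.
    by move/(GP _ _ _ (Kio x)); rewrite lio.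
  by move=> h; apply/(GP _ _ _ (Kio x)); rewrite lio.
Qed.

End PolishEmbedding.

Lemma standard_borel_sborel (R : realType) T (S : set (set T)) :
  standard_borel R S -> sborel S.
Proof.
move=> [P [f [polP [g fg gf] SE]]].
(* The embedding of a Polish space starts from a point, so the empty space is treated apart. *)
have [[t0 _]|nT] := pselect (exists t : T, True); last first.
  have all0 (A : set T) : A = set0 by rewrite -subset0 => t; case: nT; exists t.
  exists (fun=> fun=> 0%N); split.
  - by move=> t; case: nT; exists t.
  - rewrite (_ : range _ = set0); first exact: bor_set0.
    by rewrite -subset0 => x [t]; case: nT; exists t.
  - rewrite SE; apply/seteqP; split => A _; rewrite (all0 A).
      by exists set0 => //; exact: bor_set0.
    by exists set0 => //; apply: (sa_cst _ False); exact: smallest_sigma_algebra.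
have [io [ioi bio iob ioU]] := polish_embedding polP (f t0).
exists (io \o f); split.
- by apply: inj_comp => //; exact: can_inj fg.
- rewrite (_ : range _ = range io)//; apply/seteqP; split => _ [x _ <-]; first by exists (f x).
  by exists (g x) => //=; rewrite gf.
- rewrite SE; apply/seteqP; split => _ [B bB <-].
    by have [B' bB' <-] := ioU _ bB; exists B'.
  by exists (io @^-1` B) => //; exact: iob.
Qed.

(** * Closed subsets of the Baire space as Polish spaces *)

Section BaireMetric.
Variable R : realType.
Local Open Scope ring_scope.

Definition dN (x y : baire) : R :=
  if pselect (exists n, x n != y n) is left ex then (ex_minn ex).+1%:R^-1 else 0.

Lemma dN_cases x y : (dN x y = 0 /\ x = y) \/
  exists n, [/\ dN x y = n.+1%:R^-1, x n <> y n & agr n x y].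
Proof.
rewrite /dN; case: pselect => [ex|nex].
  right; case: ex_minnP => n /eqP xy nmin; exists n; split => // i il.
  by apply/eqP; rewrite -[_ == _]negbK; apply/negP => /nmin; rewrite leqNgt il.
left; split => //; apply/funext => n; apply/eqP; rewrite -[_ == _]negbK.
by apply/negP => h; apply: nex; exists n.
Qed.

Lemma dN_lt x y n : dN x y < n.+1%:R^-1 <-> agr n.+1 x y.
Proof.
have [[-> ->]|[m [-> xy h]]] := dN_cases x y.
  by split => // _; rewrite invr_gt0 ltr0Sn.
rewrite ltf_pV2 ?posrE ?ltr0Sn// ltr_nat; split => [mn i il|/(_ m)].
  by apply: h; exact: leq_trans il mn.
by move=> hm; rewrite ltnS ltnNge; apply/negP => mn; apply: xy; exact: hm.
Qed.

Lemma dNxx x : dN x x = 0.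
Proof. by have [[]//|[n [_ []]]] := dN_cases x x. Qed.

Lemma dN_ge0 x y : 0 <= dN x y.
Proof. by have [[->]|[n [-> _ _]]] := dN_cases x y; rewrite ?invr_ge0. Qed.

Lemma dN_ge x y n : x n <> y n -> n.+1%:R^-1 <= dN x y.
Proof. by move=> xy; rewrite leNgt; apply/negP => /dN_lt /(_ n (ltnSn n)). Qed.

Lemma dN_eq0 x y : dN x y = 0 -> x = y.
Proof.
have [[]//|[n [-> _ _]]] := dN_cases x y.
by move/eqP; rewrite invr_eq0 pnatr_eq0.
Qed.

Lemma dN_sym x y : dN x y = dN y x.
Proof.
have le a b : dN a b <= dN b a.
  have [[->] _|[n [-> h _]]] := dN_cases a b; first exact: dN_ge0.
  by apply: dN_ge => /esym.
by apply/eqP; rewrite eq_le !le.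
Qed.

Lemma dN_triangle y x z : dN x z <= dN x y + dN y z.
Proof.
have [[-> _]|[n [-> xz _]]] := dN_cases x z; first by rewrite addr_ge0 ?dN_ge0.
have [xy|/dN_ge h] := pselect (x n = y n).
  apply: (@le_trans _ _ (dN y z)); last by rewrite lerDr dN_ge0.
  by apply: dN_ge; rewrite -xy.
by apply: (le_trans h); rewrite lerDl dN_ge0.
Qed.

End BaireMetric.

(** [R] is recorded as the field in which the metric of this copy of the subtype takes its
    values. *)
Definition closed_space (R : realType) (F : set baire) := {z : baire | F z}.

Section ClosedSpace.
Variables (R : realType) (F : set baire).
Local Notation P := (closed_space R F).
Local Open Scope ring_scope.

HB.instance Definition _ := gen_eqMixin P.
HB.instance Definition _ := gen_choiceMixin P.

Definition closed_dist (x y : P) : R := dN R (sval x) (sval y).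

Let closed_dist0 x y : closed_dist x y = 0 -> x = y.
Proof. by move/dN_eq0/sig_inj. Qed.

HB.instance Definition _ := @isMetric.Build R P closed_dist
  (fun x => dNxx R (sval x)) closed_dist0 (fun x y => dN_sym R (sval x) (sval y))
  (fun y x z => dN_triangle R (sval y) (sval x) (sval z)).

Lemma closed_mdist (x y : P) n : mdist x y < n.+1%:R^-1 <-> agr n.+1 (sval x) (sval y).
Proof. exact: dN_lt. Qed.

Lemma closed_nbhs (x : P) (A : set P) :
  nbhs x A <-> exists n, forall y : P, agr n.+1 (sval x) (sval y) -> A y.
Proof.
split => [/nbhs_ballP[q /= q0 qA]|[n h]].
  have [n] := ltr_add_invr q0; rewrite add0r => nq.
  exists n => y /closed_mdist xy; apply: qA; rewrite ballEmdist /=.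
  exact: lt_trans xy nq.
apply/nbhs_ballP; exists n.+1%:R^-1 => /=; first by rewrite invr_gt0 ltr0Sn.
by move=> y; rewrite ballEmdist /= => /closed_mdist/h.
Qed.

Lemma closed_space_polish : clo F -> polish P.
Proof.
move=> cF; split.
  have [[p _]|nP] := pselect (exists p : P, True); last first.
    by exists set0; [exact: countable0|move=> O [x]; case: nP; exists x].
  have /choice[d dP] : forall s, exists x : P, (exists y : P, pre s (sval y)) -> pre s (sval x).
    move=> s; have [[y sy]|] := pselect (exists y : P, pre s (sval y)); first by exists y.
    by exists p.
  exists (range d).
    by apply: sub_countable (card_image_le _ _) (countableP _).
  move=> O [x Ox]; rewrite openE => /(_ x Ox) /closed_nbhs[n h].
  exists (d (mkseq (sval x) n.+1)); split; last by eexists.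
  have : pre (mkseq (sval x) n.+1) (sval (d (mkseq (sval x) n.+1))).
    by apply: dP; exists x; exact: pre_mkseq.
  by rewrite /pre size_mkseq => /mkseq_agrP xd; apply: h => i /xd.
move=> Fi PF /cauchyP ce.
have /choice[z zP] : forall n, exists x : P, Fi [set y : P | agr n.+1 (sval x) (sval y)].
  move=> n; have [|x Fx] := ce n.+1%:R^-1; first by rewrite invr_gt0 ltr0Sn.
  by exists x; apply: filterS Fx => y; rewrite ballEmdist /= => /closed_mdist.
(* Diagonal limit: [z n] agrees on its first n+1 coordinates with all points of some set of the
   filter. *)
pose l : baire := fun n => sval (z n) n.
have lW n : Fi [set y : P | agr n l (sval y)].
  elim: n => [|n IH]; first by apply: filterS filterT => y _ i.
  apply: filterS2 IH (zP n) => y h1 h2 i; rewrite ltnS leq_eqVlt => /orP[/eqP ->|/h1//].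
  by rewrite /l h2.
have Fl : F l.
  apply: cF => n; have [y hy] := filter_ex (lW n).
  by exists (sval y); split => //; exact: (proj2_sig y).
exists (exist _ l Fl) => A /closed_nbhs[n h]; rewrite nbhs_filterE.
by apply: filterS (lW n.+1) => y; exact: h.
Qed.

End ClosedSpace.

(** The Borel range of the embedding is the injective projection of a closed set [F], and by
    Lusin-Souslin the inverse [b] is Borel; [T] is thereby identified with the Polish space [F],
    with the right Borel sets. *)
Lemma sborel_standard_borel (R : realType) T (S : set (set T)) :
  sborel S -> standard_borel R S.
Proof.
move=> /[dup] /sborel_sa Ssa [i [iinj bi SE]].
have [F [cF FP Fu]] := bor_kset bi.
have [||b [bb bP _]] := @lusin_souslin F pr0 (clo_bor cF).
- exact: (bf_pr0 bor_sa bf_id).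
- move=> x x' Fx Fx' xx'; rewrite -(pair_pr x) -(pair_pr x') xx'; congr pairN.
  by apply: (Fu (pr0 x)); rewrite ?pair_pr// xx' pair_pr.
have Fi t : F (b (i t)) /\ pr0 (b (i t)) = i t.
  have /FP[y Fy] : range i (i t) by exists t.
  by have := bP _ Fy; rewrite pr0_pair => ->; rewrite pr0_pair.
have bi' : borel_fun S bor i by move=> B bB; rewrite SE; exists B.
have bbi : borel_fun S bor (b \o i) by exact: borel_fun_comp bi' bb.
pose P := closed_space R F.
pose f t : P := exist _ (b (i t)) (Fi t).1.
have opS : sigma_algebra setT <<s @open P >> by exact: smallest_sigma_algebra.
have bval : borel_fun <<s @open P >> bor (fun p : P => sval p).
  apply: borel_funN => // n k; apply: sub_sigma_algebra.
  rewrite openE => p /= pk; apply/closed_nbhs; exists n => y /(_ n (ltnSn n)) /= e.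
  by rewrite -e.
exists P, f; split.
- exact: closed_space_polish.
- have /choice[g gP] : forall p : P, exists t, i t = pr0 (sval p).
    move=> p; have : range i (pr0 (sval p)).
      by apply/FP; exists (pr1 (sval p)); rewrite pair_pr; exact: (proj2_sig p).
    by case=> t _ ?; exists t.
  exists g => [t|p]; first by apply: iinj; rewrite gP /=; case: (Fi t).
  by apply: sig_inj; rewrite /= gP bP//; exact: (proj2_sig p).
- apply/seteqP; split => [A SA|_ [B bB <-]]; last first.
    apply: (borel_fun_gen (G := @open P)) bB => // O oO.
    apply: (@sa_ext _ S (fun t => exists s, pre s (b (i t)) /\ [set p : P | pre s (sval p)] `<=` O) (f @^-1` O)).
      move=> t; split => [[s [st sO]]|Ot]; first exact: sO.
      move: oO; rewrite openE => /(_ _ Ot) /closed_nbhs[n h].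
      exists (mkseq (b (i t)) n.+1); split; first exact: pre_mkseq.
      move=> p; rewrite /mkset /pre size_mkseq => /mkseq_agrP tp.
      by apply: h => j /tp.
    apply: (sa_ex Ssa) => s; apply: (sa_and Ssa); last exact: sa_cst.
    exact: (bf_mkseq Ssa _ (fun s' => s' = s) bbi).
  move: SA; rewrite SE => -[B bB <-].
  exists ((fun p : P => pr0 (sval p)) @^-1` B).
    exact: (bf_pr0 opS bval).
  by apply/seteqP; split => t /=; rewrite (Fi t).2.
Qed.

(** * Borel maps on standard Borel spaces *)

Section Sborel.
Variables (T : Type) (S : set (set T)) (i : T -> baire).
Hypothesis iS : embeds S i.

Lemma embeds_sa : sigma_algebra setT S.
Proof. by apply: sborel_sa; exists i. Qed.

Lemma embeds_bf : borel_fun S bor i.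
Proof. by case: iS => _ _ -> B bB; exists B. Qed.

Lemma embeds_image A : S A -> bor (i @` A).
Proof.
case: iS => ii bi -> [B bB <-].
apply: (@sa_ext _ bor (fun x => range i x /\ B x) (i @` _)).
  by move=> x; split => [[[t _ <-] Bt]|[t Bt <-]]; [exists t|split => //; exists t].
exact: (sa_and bor_sa).
Qed.

(** Makes the theorems on the Baire space available for maps defined on [T]; the extension by the
    zero sequence is Borel because the range of [i] is. *)
Lemma embeds_ext (g : T -> baire) : borel_fun S bor g ->
  exists2 g', borel_fun bor bor g' & forall t, g' (i t) = g t.
Proof.
move=> bg; have [ii bi SE] := iS.
have /choice[g' gP] : forall x : baire, exists y, (exists2 t, i t = x & g t = y) \/ (~ range i x /\ y = fun=> 0%N).
  move=> x; have [[t _ tx]|nx] := pselect (range i x); last by exists (fun=> 0%N); right.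
  by exists (g t); left; exists t.
have gi t : g' (i t) = g t.
  by have [[t' /ii -> //]|[[]]] := gP (i t); exists t.
exists g' => //; apply: borel_funN => // n k.
apply: (@sa_ext _ bor (fun x => (i @` [set t | g t n = k]) x \/ (~ range i x /\ 0%N = k))).
  move=> x; split => [[[t tk <-]|[nx <-]]|]; first by rewrite gi.
    by have [[t it]|[_ ->]//] := gP x; case: nx; exists t.
  have [[t <- <-] ?|[nx ->] ?] := gP x; last by right.
  by left; exists t.
apply: (sa_or bor_sa); first exact: (embeds_image (bfN _ _ bg)).
apply: (sa_and bor_sa); last exact: sa_cst.
exact: (sa_not bor_sa bi).
Qed.

Lemma sborel_lusin_souslin (g : T -> baire) A : borel_fun S bor g -> S A ->
  (forall x y, A x -> A y -> g x = g y -> x = y) -> bor (g @` A).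
Proof.
move=> bg SA gi; have [g' bg' gg'] := embeds_ext bg.
have [|_ [_ _]] := @lusin_souslin (i @` A) g' (embeds_image SA) bg'.
  by move=> _ _ [x Ax <-] [y Ay <-]; rewrite !gg' => /(gi _ _ Ax Ay) ->.
rewrite image_comp; congr bor; apply/seteqP.
by split => _ [x Ax <-]; exists x => //=; rewrite gg'.
Qed.

(** The image is the preimage under [j] of a Borel set of codes. A Borel injection [j] of the target
    is all that this takes, so the lemma applies to disjoint unions coded by [dunion_code]. *)
Lemma borel_image U (S' : set (set U)) (j : U -> baire) (h : T -> U) A :
  borel_fun S' bor j -> injective j -> borel_fun S S' h -> S A ->
  (forall x y, A x -> A y -> h x = h y -> x = y) -> S' (h @` A).
Proof.
move=> bj ji bh SA hi.
have /bj : bor ((j \o h) @` A).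
  apply: sborel_lusin_souslin => //; first exact: borel_fun_comp bh bj.
  by move=> x y Ax Ay /ji; exact: hi.
congr S'; apply/seteqP; split => [u [x Ax /ji <-]|_ [x Ax <-]]; by exists x.
Qed.

Lemma sborel_set1 x : S [set x].
Proof.
have [ii _ SE] := iS; rewrite SE; exists [set i x].
  exact: (bf_eq bor_sa bf_id (bf_cst bor_sa (i x))).
by apply/seteqP; split => [y /ii|y -> //].
Qed.

Lemma sborel_countable A : countable A -> S A.
Proof. exact: (sa_countable embeds_sa sborel_set1). Qed.

Lemma sborel_perfect A : S A -> ~ countable A ->
  exists c : baire -> T, [/\ borel_fun bor S c, injective c & forall al, A (c al)].
Proof.
move=> SA nT; have [ii bi SE] := iS.
have [|c [bc cr ci]] := @perfect_borel (i @` A) id (embeds_image SA) bf_id.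
  apply: contra_not nT; rewrite image_id; apply: sub_countable.
  by apply: (@card_le_inj _ _ _ _ i) => [x Ax|x y _ _ /ii//]; exists x.
have /choice[c' cP] : forall al, exists t, A t /\ i t = c al.
  by move=> al; have [t ? <-] := cr al; exists t.
exists c'; split => [B|al al' h|al]; last by case: (cP al).
  rewrite SE => -[B' bB' <-]; have := bc B' bB'; congr bor.
  by apply/seteqP; split => al /=; have [_ ->] := cP al.
by apply: ci => /=; have [_ <-] := cP al; have [_ <-] := cP al'; rewrite h.
Qed.

End Sborel.

(** * The Borel isomorphism theorem *)

Lemma bijective_of T U (h : T -> U) :
  injective h -> (forall y, exists x, h x = y) -> bijective h.
Proof.
by move=> hi /choice[g hg]; exists g => // x; apply: hi; rewrite hg.
Qed.

(** The classical construction stays Borel because [f] and [g], being injective, map Borel sets to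
    Borel sets; in particular the set [Ai], on which [h] follows [f], is Borel. *)
Lemma borel_Schroeder_Bernstein T U (S : set (set T)) (S' : set (set U)) f g :
  sborel S -> sborel S' -> borel_fun S S' f -> borel_fun S' S g ->
  injective f -> injective g -> exists2 h : T -> U, borel_fun S S' h & bijective h.
Proof.
move=> [i iS] [j jS'] bf bg fi gi.
have SS := embeds_sa iS; have SS' := embeds_sa jS'.
have [ii _ _] := iS; have [ji _ _] := jS'.
have imf A : S A -> S' (f @` A).
  by move=> SA; apply: (borel_image iS (embeds_bf jS')) => // x y _ _ /fi.
have img A : S' A -> S (g @` A).
  by move=> SA; apply: (borel_image jS' (embeds_bf iS)) => // x y _ _ /gi.
pose fix A n := if n is n'.+1 then g @` (f @` A n') else ~` (range g).
have SA n : S (A n).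
  elim: n => [|n IH] /=; last exact/img/imf.
  by apply: (sa_not SS); apply: img; have := sa_cst SS' True; congr S'; apply/seteqP.
pose Ai := [set x | exists n, A n x].
have SAi : S Ai by exact: (sa_ex SS).
have /choice[h hP] : forall x, exists y, (Ai x /\ y = f x) \/ (~ Ai x /\ g y = x).
  move=> x; have [Ax|nAx] := pselect (Ai x); first by exists (f x); left.
  have [[y _ yx]|ny] := pselect (range g x); first by exists y; right.
  by exfalso; apply: nAx; exists 0%N.
have gAi y : Ai (g y) -> exists2 a, Ai a & f a = y.
  case=> -[|n] /=; first by case; exists y.
  by move=> [_ [a Aa <-] /gi ?]; exists a => //; exists n.
have fAi x : Ai x -> Ai (g (f x)).
  by move=> [n An]; exists n.+1; exists (f x) => //; exists x.
exists h.
  move=> B SB; apply: (@sa_ext _ S (fun x => (Ai x /\ B (f x)) \/ (~ Ai x /\ (g @` B) x)) (h @^-1` B)).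
    move=> x; split.
      move=> [[Ax Bf]|[nAx [y By gy]]]; have [[Ax' hx]|[nAx' hx]] := hP x => //.
        by rewrite /preimage /mkset hx.
      by rewrite /preimage /mkset (_ : h x = y)//; apply: gi; rewrite hx gy.
    move=> Bh; have [[Ax hx]|[nAx hx]] := hP x; first by left; rewrite -hx.
    by right; split => //; exists (h x).
  apply: (sa_or SS); apply: (sa_and SS) => //; first exact: bf.
    exact: (sa_not SS).
  exact: img.
apply: bijective_of => [x x' hh|y].
  have [[Ax hx]|[nAx hx]] := hP x; have [[Ax' hx']|[nAx' hx']] := hP x'.
  - by apply: fi; rewrite -hx -hx'.
  - by exfalso; apply: nAx'; rewrite -hx' -hh hx; exact: fAi.
  - by exfalso; apply: nAx; rewrite -hx hh hx'; exact: fAi.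
  - by rewrite -hx -hx' hh.
have [/gAi[a Aa <-]|ng] := pselect (Ai (g y)).
  by exists a; have [[_ ->]//|[]] := hP a.
by exists (g y); have [[]//|[_ /gi]] := hP (g y).
Qed.

Lemma card_eq_fun T U : [set: T] #= [set: U] -> exists h : T -> U, bijective h.
Proof.
move=> /card_bijP[f [g fg gf]].
exists (fun x => val (f (exist _ x (mem_setT x)))).
exists (fun y => val (g (exist _ y (mem_setT y)))) => x.
  by rewrite (_ : exist _ _ _ = f (exist _ x (mem_setT x))) ?fg//; exact: val_inj.
by rewrite (_ : exist _ _ _ = g (exist _ x (mem_setT x))) ?gf//; exact: val_inj.
Qed.

Lemma borel_isomorphism T U (S : set (set T)) (S' : set (set U)) :
  sborel S -> sborel S' -> [set: T] #= [set: U] ->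
  exists2 h : T -> U, borel_fun S S' h & bijective h.
Proof.
move=> sS sS' TU; have [i iS] := sS; have [j jS'] := sS'.
have [cT|nT] := pselect (countable [set: T]).
  (* All subsets of a countable space are Borel, so any bijection will do. *)
  have [h hb] := card_eq_fun TU; exists h => // B _.
  by apply: (sborel_countable iS); apply: sub_countable cT; exact: subset_card_le.
have nU : ~ countable [set: U] by rewrite -(eq_countable TU).
have ST : S setT by have := sa_cst (embeds_sa iS) True; congr S; apply/seteqP.
have SU : S' setT by have := sa_cst (embeds_sa jS') True; congr S'; apply/seteqP.
have [c [bc ci _]] := sborel_perfect iS ST nT.
have [c' [bc' ci' _]] := sborel_perfect jS' SU nU.
have [[ii _ _] [ji _ _]] := (iS, jS').
apply: (@borel_Schroeder_Bernstein _ _ _ _ (c' \o i) (c \o j)) => //.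
- exact: borel_fun_comp (embeds_bf iS) bc'.
- exact: borel_fun_comp (embeds_bf jS') bc.
- exact: inj_comp.
- exact: inj_comp.
Qed.

(** * Products, disjoint unions and cardinalities *)

Lemma prod_sa T U (S : set (set T)) (S' : set (set U)) :
  sigma_algebra setT (prod_borel S S').
Proof. exact: smallest_sigma_algebra. Qed.

Lemma dunion_sa I (T : I -> Type) (S : forall i, set (set (T i))) :
  (forall i, sigma_algebra setT (S i)) -> sigma_algebra setT (dunion_borel S).
Proof.
move=> SS; split => [i|A SA i|F SF i].
- exact: (sa_cst (SS i) False).
- by rewrite setTD; exact: (sa_not (SS i) (SA i)).
- by rewrite preimage_bigcup; case: (SS i) => _ _; apply => n; exact: SF.
Qed.

Section ProdBorel.
Variables (T U : Type) (S : set (set T)) (S' : set (set U)).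
Hypotheses (SS : sigma_algebra setT S) (SS' : sigma_algebra setT S').

Lemma prod_rect A B : S A -> S' B -> prod_borel S S' [set p | A p.1 /\ B p.2].
Proof. by move=> SA SB; apply: sub_sigma_algebra; exists A => //; exists B. Qed.

Lemma prod_fst A : S A -> prod_borel S S' [set p | A p.1].
Proof.
move=> SA; have := prod_rect SA (sa_cst SS' True); congr prod_borel.
by apply/seteqP; split => p; [case|].
Qed.

Lemma prod_snd B : S' B -> prod_borel S S' [set p | B p.2].
Proof.
move=> SB; have := prod_rect (sa_cst SS True) SB; congr prod_borel.
by apply/seteqP; split => p; [case|].
Qed.

End ProdBorel.

Lemma prod_map T U T' U' (S1 : set (set T)) (S2 : set (set U)) (S3 : set (set T')) (S4 : set (set U')) k l :
  borel_fun S1 S3 k -> borel_fun S2 S4 l ->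
  borel_fun (prod_borel S1 S2) (prod_borel S3 S4) (fun p => (k p.1, l p.2)).
Proof.
move=> bk bl; apply: borel_fun_gen; first exact: prod_sa.
by move=> _ [A SA [B SB <-]]; apply: (prod_rect (bk _ SA) (bl _ SB)).
Qed.

Lemma existT_inj2 I (P : I -> Type) i (x y : P i) : existT P i x = existT P i y -> x = y.
Proof.
move=> e; have := projT2_eq e.
by rewrite (Prop_irrelevance (projT1_eq e) erefl).
Qed.

Lemma has_card_eq T U (A : set T) (B : set U) m : A #= B -> has_card A m -> has_card B m.
Proof. by move=> AB; case: m => [n||] /= h; rewrite -(card_eql AB). Qed.

Lemma has_card_uniq T (A : set T) m m' : has_card A m -> has_card A m' -> m = m'.
Proof.
have fin n : `I_n #= [set: nat] -> False.
  move=> h; apply: infinite_nat; exists n; by rewrite card_eq_sym.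
have fin2 n : `I_n #= [set: nat -> bool] -> False.
  move=> h; apply: uncountable_cantor; rewrite -(eq_countable h).
  exact: finite_set_countable (finite_II n).
have nat2 : [set: nat] #= [set: nat -> bool] -> False.
  by move=> h; apply: uncountable_cantor; rewrite -(eq_countable h); exact: countableP.
case: m => [n||]; case: m' => [n'||] //= h; rewrite (card_eql h).
- by move/card_eq_II => [->].
- by move/fin.
- by move/fin2.
- by rewrite card_eq_sym => /fin.
- by move/nat2.
- by rewrite card_eq_sym => /fin2.
- by rewrite card_eq_sym => /nat2.
Qed.

(** * Fine shapes of parametrized relations *)

Section FineShape.
Variable R : realType.

Lemma borelT (X : stdBorelType R) : sborel (@borel R X).
Proof. exact: standard_borel_sborel (borelP X). Qed.

Lemma iso_same_shape (X Y : stdBorelType R) (E : X -> X -> Prop) (F : Y -> Y -> Prop) :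
  borel_isomorphic E F -> same_fine_shape E F.
Proof.
move=> [h [_ [g hg gh] hEF]] m.
have hi := can_inj hg.
apply: (@card_eq_bij _ _ _ _ (fun C => h @` C)).
- move=> _ [[x ->] hC]; split.
    exists (h x); apply/seteqP; split => [_ [y /hEF ? <-]//|y Fy].
    by exists (g y); [apply/hEF; rewrite gh|].
  by apply: has_card_eq hC; rewrite card_eq_sym; apply: inj_card_eq => x1 x2 _ _ /hi.
- move=> C C' _ _ CC'; apply/seteqP; split => x Cx.
    have : (h @` C') (h x) by rewrite -CC'; exists x.
    by move=> [y Cy /hi <-].
  have : (h @` C) (h x) by rewrite CC'; exists x.
  by move=> [y Cy /hi <-].
- move=> C [[y ->] hC]; exists [set x | F y (h x)]; last first.
    by apply/seteqP; split => [_ [x ? <-]//|z ?]; exists (g z); rewrite /= gh.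
  split; first by exists (g y); apply/seteqP; split => x; [move=> Fy; apply/hEF|move/hEF]; rewrite gh.
  apply: has_card_eq hC; apply: (@card_eq_bij _ _ _ _ g) => [z Fz|z z' _ _ /(can_inj gh)//|x Fx].
    by rewrite /= gh.
  by exists (h x).
Qed.

(** A point [z] of [Z m] corresponds to the class that [phi] maps onto the copy of [Y m] above
    [z]. *)
Lemma param_count (X : stdBorelType R) (E : X -> X -> Prop) (Z Y : Cplus -> stdBorelType R)
  (phi : X -> {m : Cplus & (Z m * Y m)%type}) : borel_parametrization E phi ->
  forall m, [set: Z m] #= classes_of_card E m.
Proof.
move=> [Yc _ [psi fK Kf] hE] m.
have cls (m' : Cplus) (z : Z m') : exists x, [set x' | E x x'] = [set x' | exists y, phi x' = existT _ m' (z, y)] /\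
    has_card [set x' | E x x'] m'.
  (* No cardinal in [Cplus] is 0, so every [z] is attained by a class. *)
  have [y0 _] : exists y : Y m', True.
    have := Yc m'; case: (pselect (exists y : Y m', True)) => // nY.
    have -> : [set: Y m'] = set0 by rewrite -subset0 => y _; apply: nY; exists y.
    case: m' {z nY} => [n||] /=; rewrite card_eq_sym card_eq0 => /eqP/seteqP[].
    + by move=> /(_ 0%N) /(_ isT).
    + by move=> /(_ 0%N I).
    + by move=> /(_ (fun=> true) I).
  pose x := psi (existT _ m' (z, y0)).
  have Ex : [set x' | E x x'] = [set x' | exists y, phi x' = existT _ m' (z, y)].
    apply/seteqP; split => x' /=; rewrite hE /x Kf /dunion_pi1 /=.
      case: (phi x') => m1 [z1 y1] /= e; have e1 : m' = m1 := projT1_eq e.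
      subst m1; have -> : z = z1 := existT_inj2 e.
      by exists y1.
    by move=> [y ->].
  exists x; split => //; rewrite Ex; apply: has_card_eq (Yc m').
  apply: (@card_eq_bij _ _ _ _ (fun y => psi (existT _ m' (z, y)))) => //.
  - by move=> y _; exists y; rewrite Kf.
  - by move=> y y' _ _ /(can_inj Kf) e; have [] := existT_inj2 e.
  - by move=> x' [y e]; exists y => //; rewrite -e fK.
apply: (@card_eq_bij _ _ _ _ (fun z : Z m => [set x' | exists y, phi x' = existT _ m (z, y)])).
- by move=> z _; have [x [<- hc]] := cls m z; split => //; exists x.
- move=> z z' _ _ zz'; have [x [Ex hc]] := cls m z.
  have [y e] : [set x' | exists y, phi x' = existT _ m (z, y)] x.
    by rewrite -Ex /= hE.
  have : [set x' | exists y, phi x' = existT _ m (z, y)] x by exists y.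
  by rewrite zz' => -[y']; rewrite e => e'; have [] := existT_inj2 e'.
- move=> C [[x ->] hC].
  case e : (phi x) => [m1 [z y]].
  have [x1 [Ex1 hx1]] := cls m1 z.
  have Exx : [set x' | E x x'] = [set x' | E x1 x'].
    apply/seteqP; rewrite Ex1; split => x' /=; rewrite hE e /dunion_pi1 /=.
      case: (phi x') => m2 [z2 y2] /= e2; have e3 : m1 = m2 := projT1_eq e2.
      by subst m2; have -> : z = z2 := existT_inj2 e2; exists y2.
    by move=> [y' ->].
  rewrite Exx in hC *; have e4 := has_card_uniq hx1 hC; subst m1.
  by exists z.
Qed.

Lemma dep_choice I (U : I -> Type) (P : forall i, U i -> Prop) :
  (forall i, exists y, P i y) -> exists f : forall i, U i, forall i, P i (f i).
Proof. by move=> h; exists (fun i => projT1 (cid (h i))) => i; case: cid. Qed.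

Definition Cplus_code (m : Cplus) : nat :=
  match m with Cfin n => n.+2 | Caleph0 => 0 | Ccontinuum => 1 end.

Lemma Cplus_code_inj : injective Cplus_code.
Proof. by case=> [n||] [n'||] //= [->]. Qed.

Lemma dunion_code (Z Y : Cplus -> stdBorelType R) :
  exists2 j : {m : Cplus & (Z m * Y m)%type} -> baire, injective j &
    borel_fun (dunion_borel (fun m => prod_borel (@borel R (Z m)) (@borel R (Y m)))) bor j.
Proof.
have /dep_choice[iZ iZP] : forall m, exists i, embeds (@borel R (Z m)) i.
  by move=> m; exact: borelT.
have /dep_choice[iY iYP] : forall m, exists i, embeds (@borel R (Y m)) i.
  by move=> m; exact: borelT.
exists (fun p => pairN (fun=> Cplus_code (projT1 p)) (pairN (iZ _ (projT2 p).1) (iY _ (projT2 p).2))).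
  move=> [m [z y]] [m' [z' y']] /= e.
  have := congr1 (fun x => pr0 x 0%N) e; rewrite !pr0_pair => /Cplus_code_inj e1; subst m'.
  have := congr1 (fun x => pr0 (pr1 x)) e; rewrite !pr1_pair !pr0_pair.
  have [iZi _ _] := iZP m; have [iYi _ _] := iYP m => /iZi ->.
  by have := congr1 (fun x => pr1 (pr1 x)) e; rewrite !pr1_pair => /iYi ->.
apply: borel_funN; first by apply: dunion_sa => m; exact: prod_sa.
move=> n k m /=; have sP := prod_sa (@borel R (Z m)) (@borel R (Y m)).
apply: (@bfN _ _ (fun p : Z m * Y m => pairN (fun=> Cplus_code m) (pairN (iZ m p.1) (iY m p.2))) n k).
apply: (bf_pair sP); first exact: (bf_cst sP).
apply: (bf_pair sP) => B bB.
  exact: (prod_fst (embeds_sa (iYP m)) (embeds_bf (iZP m) bB)).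
exact: (prod_snd (embeds_sa (iZP m)) (embeds_bf (iYP m) bB)).
Qed.

Lemma same_shape_iso (X Y : stdBorelType R) (E : X -> X -> Prop) (F : Y -> Y -> Prop) :
  borel_parametrizable E -> borel_parametrizable F ->
  same_fine_shape E F -> borel_isomorphic E F.
Proof.
move=> [Z [W [phi phiP]]] [Z' [W' [phi' phiP']]] EF.
have ZZ' m : [set: Z m] #= [set: Z' m].
  rewrite (card_eql (param_count phiP m)) (card_eql (EF m)) card_eq_sym.
  exact: param_count phiP' m.
have [Wc bphi [psi phiK psiK] phiE] := phiP; have [Wc' bphi' [psi' phiK' psiK'] phiE'] := phiP'.
have WW' m : [set: W m] #= [set: W' m].
  have h1 := Wc m; have h2 := Wc' m.
  by case: m h1 h2 => [n||] /= h1 h2; rewrite (card_eql h1) card_eq_sym.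
have /dep_choice[k kP] : forall m, exists k : Z m -> Z' m, borel_fun (@borel R _) (@borel R _) k /\ bijective k.
  by move=> m; have [k ? ?] := borel_isomorphism (borelT (Z m)) (borelT (Z' m)) (ZZ' m); exists k.
have /dep_choice[l lP] : forall m, exists l : W m -> W' m, borel_fun (@borel R _) (@borel R _) l /\ bijective l.
  by move=> m; have [l ? ?] := borel_isomorphism (borelT (W m)) (borelT (W' m)) (WW' m); exists l.
pose Th (p : {m : Cplus & (Z m * W m)%type}) : {m : Cplus & (Z' m * W' m)%type} :=
  existT _ (projT1 p) (k _ (projT2 p).1, l _ (projT2 p).2).
have bTh : borel_fun (dunion_borel (fun m => prod_borel (@borel R (Z m)) (@borel R (W m))))
    (dunion_borel (fun m => prod_borel (@borel R (Z' m)) (@borel R (W' m)))) Th.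
  by move=> B SB m; have [[bk _] [bl _]] := (kP m, lP m); exact: (prod_map bk bl (SB m)).
exists (psi' \o Th \o phi); split.
- move=> B bB; have [j ji bj] := dunion_code Z' W'; have [i iS] := borelT Y.
  (* The inverse of [phi'] is Borel because the injection [phi'] maps Borel sets to Borel sets. *)
  have : dunion_borel (fun m => prod_borel (@borel R (Z' m)) (@borel R (W' m))) (phi' @` B).
    by apply: (borel_image iS bj ji bphi' bB) => x y _ _ /(can_inj phiK').
  move=> /bTh /bphi; congr borel; apply/seteqP; split => x /=.
    by move=> [y By e]; rewrite /= -e phiK'.
  by move=> Bx; exists (psi' (Th (phi x))).
- apply: bij_comp; last by exists psi.
  apply: bij_comp; first by exists phi'.
  apply: bijective_of => [[m [z w]] [m' [z' w']]|[m [z w]]].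
    rewrite /Th /= => e; have e1 : m = m' := projT1_eq e; subst m'.
    move: (existT_inj2 e) => [].
    by have [[_ /bij_inj kb] [_ /bij_inj lb]] := (kP m, lP m) => /kb -> /lb ->.
  have [[_ [k' _ kk']] [_ [l' _ ll']]] := (kP m, lP m).
  by exists (existT _ m (k' z, l' w)); rewrite /Th /= kk' ll'.
- move=> x y; rewrite phiE phiE' /= !psiK'; case: (phi x) => m [z w]; case: (phi y) => m' [z' w'].
  rewrite /dunion_pi1 /Th /=; split => e; have e1 : m = m' := projT1_eq e; subst m'.
    by rewrite (existT_inj2 e).
  by have [_ /bij_inj kb] := kP m; rewrite (kb _ _ (existT_inj2 e)).
Qed.

End FineShape.

(** * Smooth equivalence relations *)

(** Zorn's lemma gives a maximal family of injective sequences in [A] with disjoint ranges; by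
    maximality only finitely many points of [A] are left over. *)
Lemma infinite_setX_nat T (A : set T) : infinite_set A ->
  [set p : T * nat | A p.1] #<= A.
Proof.
move=> Ainf.
pose P (D : set (nat -> T)) :=
  (forall s, D s -> injective s /\ forall n, A (s n)) /\
  (forall s s' n n', D s -> D s' -> s n = s' n' -> s = s').
have [D [PD Dmax]] : exists D, P D /\ forall D', D `<` D' -> ~ P D'.
  apply: Zorn_bigcup => F FP tot; split.
    by move=> s [D FD Ds]; have [h _] := FP _ FD; exact: h.
  move=> s s' n n' [D FD Ds] [D' FD' Ds'].
  have [DD'|D'D] := tot _ _ FD FD'.
    by have [_ h] := FP _ FD'; apply: h => //; exact: DD'.
  by have [_ h] := FP _ FD; apply: h => //; exact: D'D.
have [PD1 PD2] := PD.
pose rem := [set a | A a /\ forall s n, D s -> s n <> a].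
have remfin : finite_set rem.
  apply: contrapT => /infiniteP h.
  have [a0 _] : exists a : T, True.
    have [a _] := infinite_setN0 Ainf; by exists a.
  have [s [sr si]] := card_le_fun a0 h.
  apply: (Dmax (D `|` [set s])).
    split; first by move=> x Dx; left.
    move=> /(_ s (or_intror erefl)) Ds.
    by have [_ /(_ s 0%N Ds)] := sr 0%N I.
  split => [s' [/PD1//|->]|s1 s2 n1 n2 [D1|->] [D2|->] e //].
  - split => [x y|n]; first exact: si.
    by case: (sr n I).
  - exact: PD2 e.
  - by have [_ /(_ s1 n1 D1)] := sr n2 I.
  - by have [_ /(_ s2 n2 D2 (esym e))] := sr n1 I.
have [s0 Ds0] : exists s, D s.
  apply: contrapT => nD; apply: Ainf; apply: sub_finite_set remfin => a Aa.
  by split => // s n Ds; case: nD; exists s.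
have /countable_injP[idx idxi] := finite_set_countable remfin.
have [c [d [cd dc]]] := nat_pairing.
(* The odd places of a sequence receive the copies of its own points, the even places of the fixed
   [s0] those of the leftover points. *)
have /choice[F FP] : forall p : T * nat, exists b, A p.1 ->
    (exists s n, [/\ D s, s n = p.1 & b = s (c (n, p.2)).*2.+1]) \/
    (rem p.1 /\ b = s0 (c (idx p.1, p.2)).*2).
  move=> [a k] /=; have [ra|nra] := pselect (rem a).
    by exists (s0 (c (idx a, k)).*2); right.
  have [[s [n [Ds sn]]]|ns] := pselect (exists s n, D s /\ s n = a).
    by exists (s (c (n, k)).*2.+1); left; exists s, n.
  exists a => Aa; exfalso; apply: nra; split => // s n Ds sn.
  by apply: ns; exists s, n.
have di x y : x.*2.+1 = y.*2.+1 -> x = y by move=> [] /double_inj.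
have dne x y : x.*2.+1 = y.*2 -> False.
  by move/(congr1 odd); rewrite /= !odd_double.
apply: (@card_le_inj _ _ _ _ F) => [p Ap|[a k] [a' k'] Aa Aa' FF].
  have [[s [n [/PD1[_ h] _ ->]]]|[_ ->]] := FP p Ap; first exact: h.
  by have [_] := PD1 _ Ds0; exact.
have [[s [n [Ds sa F1]]]|[ra F1]] := FP _ Aa; have [[s' [n' [Ds' sa' F2]]]|[ra' F2]] := FP _ Aa';
  rewrite F1 F2 /= in FF.
- have e : s = s' := PD2 _ _ _ _ Ds Ds' FF; subst s'.
  have [si _] := PD1 _ Ds; have /(can_inj cd)[e1 e2] := di _ _ (si _ _ FF).
  by move: sa sa' e2 => /= <- <- ->; rewrite e1.
- have e : s = s0 := PD2 _ _ _ _ Ds Ds0 FF; subst s.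
  by have [si _] := PD1 _ Ds; have := dne _ _ (si _ _ FF).
- have e : s0 = s' := PD2 _ _ _ _ Ds0 Ds' FF; subst s'.
  by have [si _] := PD1 _ Ds0; have := dne _ _ (esym (si _ _ FF)).
- have [si _] := PD1 _ Ds0; have /(can_inj cd)[e1 ->] := double_inj (si _ _ FF).
  by congr pair; apply: idxi; rewrite ?inE.
Qed.

(** * Borel subspaces, and counting the classes of a smooth relation *)

Definition trace (B : set baire) : set (set {x | B x}) :=
  [set (fun t => sval t) @^-1` A | A in bor].

Lemma trace_embeds B : bor B -> embeds (@trace B) (fun t => sval t).
Proof.
move=> bB; split => //; first exact: sig_inj.
by move: bB; congr bor; apply/seteqP; split => [x Bx|_ [t _ <-]];
  [exists (exist _ x Bx)|exact: (proj2_sig t)].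
Qed.

Definition borel_subspace (R : realType) B (bB : bor B) : stdBorelType R :=
  StdBorelType (sborel_standard_borel R (ex_intro _ _ (trace_embeds bB))).

Lemma card_subspace T (B : set T) : [set: {x | B x}] #= B.
Proof.
apply: (@card_eq_bij _ _ _ _ (fun t => sval t)) => [t _|t t' _ _ /sig_inj//|x Bx].
  exact: (proj2_sig t).
by exists (exist _ x Bx).
Qed.

Section Smooth.
Variables (R : realType) (X : stdBorelType R) (E : X -> X -> Prop) (f : X -> baire).
Hypotheses (bf : borel_fun (@borel R X) bor f) (fE : forall x y, E x y <-> f x = f y).

Lemma reducible_smooth : smooth E.
Proof.
exists (borel_subspace R bor_setT), (fun x => exist _ (f x) I); split => [_ [B bB <-]|x y].
  exact: bf.
by rewrite fE; split => [|/(congr1 sval)//]; move=> h; exact: sig_inj.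
Qed.

Lemma reducible_borel : borel_equivalence E.
Proof.
split; first by split => [x|x y|x y z]; rewrite !fE => // -> ->.
have [i iS] := borelT X; have SS := embeds_sa iS.
have sP := prod_sa (@borel R X) (@borel R X).
apply: (@sa_ext _ (prod_borel (@borel R X) (@borel R X)) (fun p => f p.1 = f p.2)).
  by move=> p; rewrite fE.
apply: (@bf_eq _ _ sP (fun p => f p.1) (fun p => f p.2)) => B bB.
  exact: (prod_fst SS (bf bB)).
exact: (prod_snd SS (bf bB)).
Qed.

Lemma class_borel a : @borel R X [set x | f x = a].
Proof.
have [i iS] := borelT X.
exact: (bf_eq (embeds_sa iS) bf (bf_cst (embeds_sa iS) a)).
Qed.

Lemma classE x : [set y | E x y] = [set y | f y = f x].
Proof. by apply/seteqP; split => y /=; rewrite fE. Qed.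

(** The perfect set theorem excludes cardinalities strictly between aleph_0 and the continuum. *)
Lemma borel_set_card (A : set X) : @borel R X A -> A !=set0 -> exists m, has_card A m.
Proof.
move=> SA [x0 Ax0]; have [i iS] := borelT X; have [ii _ _] := iS.
have [cA|nA] := pselect (countable A).
  have [[n An]|inf] := pselect (finite_set A); last first.
    by exists Caleph0; rewrite /= card_eq_le -/(countable A) cA /=; exact/infiniteP.
  case: n An => [|n] An; last by exists (Cfin n).
  by exfalso; move: An; rewrite II0 card_eq0 => /eqP A0; rewrite A0 in Ax0.
exists Ccontinuum; rewrite /= -(card_eqr card_baire).
have [c [_ ci cA]] := sborel_perfect iS SA nA.
rewrite card_eq_le; apply/andP; split.
  by apply: (@card_le_inj _ _ _ _ i) => // x y _ _ /ii.
by apply: (@card_le_inj _ _ _ _ c) => // x y _ _ /ci.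
Qed.

Lemma uncountable_card_continuum (A : set X) : @borel R X A -> ~ countable A ->
  has_card A Ccontinuum.
Proof.
move=> SA nA; have [|m mA] := borel_set_card SA.
  by apply/set0P/eqP => A0; apply: nA; rewrite A0; exact: countable0.
case: m mA => [n||] //= h; exfalso; apply: nA.
  by apply: finite_set_countable; exists n.+1.
by rewrite (eq_countable h); exact: countableP.
Qed.

Lemma continuum_uncountable T (A : set T) : has_card A Ccontinuum -> ~ countable A.
Proof. by move=> h; rewrite (eq_countable h); exact: uncountable_cantor. Qed.

(** Turns the counting of classes into the counting of uncountable fibres, which
    [uncountable_fibres] governs. *)
Lemma classes_fibres : classes_of_card E Ccontinuum #= [set a | ~ countable [set x | f x = a]].
Proof.
rewrite card_eq_sym; apply: (@card_eq_bij _ _ _ _ (fun a => [set x | f x = a])) => [a na|a a' na _ aa'|C [[x ->] hc]].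
- have [x xa] : [set x | f x = a] !=set0.
    by apply/set0P/eqP => A0; apply: na; rewrite /= A0; exact: countable0.
  split; first by exists x; rewrite classE xa.
  by apply: uncountable_card_continuum => //; exact: class_borel.
- have [x xa] : [set x | f x = a] !=set0.
    by apply/set0P/eqP => A0; apply: na; rewrite /= A0; exact: countable0.
  have : [set x | f x = a'] x by rewrite -aa'.
  by move: xa => /= -> ->.
- exists (f x); last by rewrite classE.
  by rewrite /= -classE; exact: continuum_uncountable.
Qed.

Lemma fibre_extend i g : embeds (@borel R X) i -> (forall x, g (i x) = f x) ->
  forall a, [set x | f x = a] #= [set u | range i u /\ g u = a].
Proof.
move=> [ii _ _] gi a; apply: (@card_eq_bij _ _ _ _ i).
- by move=> x <-; split; [exists x|rewrite gi].
- by move=> x y _ _ /ii.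
- by move=> _ [[x _ <-] ga]; exists x => //; rewrite /= -gi.
Qed.

Lemma continuum_classes : ~ countable (classes_of_card E Ccontinuum) ->
  classes_of_card E Ccontinuum #= [set: nat -> bool].
Proof.
rewrite (eq_countable classes_fibres) (card_eql classes_fibres).
have [i iS] := borelT X; have [g bg gi] := embeds_ext iS bf; have [_ bi _] := iS.
have -> : [set a | ~ countable [set x | f x = a]] =
    [set a | ~ countable [set u | range i u /\ g u = a]].
  by apply/seteqP; split => a /=; rewrite (eq_countable (fibre_extend iS gi a)).
move=> /(uncountable_fibres bi bg) h; rewrite card_eq_le h andbT.
by rewrite -(card_le_eqr card_baire); exact: card_leT.
Qed.

Lemma classes_le m : classes_of_card E m #<= [set: nat -> bool].
Proof.
rewrite -(card_le_eqr card_baire).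
have /choice[h hP] : forall C : set X, exists a : baire, classes_of_card E m C -> C = [set y | f y = a].
  move=> C; have [[[x ->] _]|nC] := pselect (classes_of_card E m C); last by exists (fun=> 0%N).
  by exists (f x) => _; rewrite classE.
by apply: (@card_le_inj _ _ _ _ h) => // C C' /hP {2}-> /hP {2}-> ->.
Qed.

End Smooth.

(** * Parametrizing relations with countably many classes of size continuum *)

Lemma smooth_reduction (R : realType) (X : stdBorelType R) (E : X -> X -> Prop) : smooth E ->
  exists f : X -> baire, borel_fun (@borel R X) bor f /\ forall x y, E x y <-> f x = f y.
Proof.
move=> [Z [f [bf fE]]]; have [i iS] := borelT Z; have [ii _ _] := iS.
exists (i \o f); split; first exact: borel_fun_comp bf (embeds_bf iS).
by move=> x y; rewrite fE /=; split => [->//|/ii].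
Qed.

(** The rank of a point of section [n] is the number of earlier sections that meet its fibre. The
    ranks in a fibre form an initial segment of [nat], so they determine its size. *)
Lemma countable_to_one_ranks B g : bor B -> borel_fun bor bor g ->
  (forall a, countable [set x | B x /\ g x = a]) ->
  exists G : nat -> set baire, [/\ forall r, bor (G r),
    forall x, B x <-> exists r, G r x,
    forall r r' x, G r x -> G r' x -> r = r',
    forall r x x', G r x -> G r x' -> g x = g x' -> x = x' &
    forall r x, G r.+1 x -> exists2 y, G r y & g y = g x].
Proof.
move=> bB bg cg; have [C0 [bC0 iC0 CB0]] := lusin_novikov bB bg cg.
pose C n := [set x | C0 n x /\ forall k, (k < n)%N -> ~ C0 k x].
have bC n : bor (C n).
  apply: (sa_and bor_sa); first exact: bC0.
  apply: (sa_all bor_sa) => k; apply: (sa_imp bor_sa); first exact: sa_cst.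
  exact: (sa_not bor_sa (bC0 k)).
have iC n x x' : C n x -> C n x' -> g x = g x' -> x = x' by move=> [h _] [h' _]; exact: iC0 h h'.
have CB x : B x <-> exists n, C n x.
  rewrite CB0; split => [[n Cn]|[n []]]; last by exists n.
  have ex : exists n, `[< C0 n x >] by exists n; exact/asboolP.
  exists (ex_minn ex); case: ex_minnP => m /asboolP Cm mmin; split => // k km /asboolP/mmin.
  by rewrite leqNgt km.
have dC n n' x : C n x -> C n' x -> n = n'.
  by move=> [Cn h] [Cn' h']; case: (ltngtP n n') => // [/h'|/h].
pose D n := g @` C n.
have bD n : bor (D n).
  by have [|_ [_ _]] := @lusin_souslin (C n) g (bC n) bg; first exact: iC.
(* Counts the sections of index below [n] that meet the fibre above [a]. *)
pose fix cnt (n : nat) (a : baire) {struct n} : nat := if n is n'.+1 then (`[< D n' a >] + cnt n' a)%N else 0%N.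
have bcnt n r : bor [set a | cnt n a = r].
  elim: n r => [|n IH] r /=; first exact: sa_cst.
  apply: (@sa_ext _ bor (fun a => (D n a /\ (cnt n a).+1 = r) \/ (~ D n a /\ cnt n a = r))).
    move=> a; split => [[[Da <-]|[nDa <-]]|]; first by rewrite asboolT.
      by rewrite asboolF.
    by have [Da|nDa] := pselect (D n a); [rewrite asboolT//; left|rewrite asboolF//; right].
  apply: (sa_or bor_sa); apply: (sa_and bor_sa).
  - exact: bD.
  - case: r => [|r].
      by apply: (@sa_ext _ bor (fun=> False)) => [a|]; [split|exact: sa_cst].
    by apply: (@sa_ext _ bor (fun a => cnt n a = r)) => [a|]; [split => [->|[]]|exact: IH].
  - exact: (sa_not bor_sa (bD n)).
  - exact: IH.
have cntS n n' a : (n < n')%N -> D n a -> (cnt n a < cnt n' a)%N.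
  elim: n' => // n' IH; rewrite ltnS leq_eqVlt => /orP[/eqP ->|nn'] Da /=.
    by rewrite asboolT.
  by apply: leq_trans (IH nn' Da) _; exact: leq_addl.
have cntI n r a : (r < cnt n a)%N -> exists k, D k a /\ cnt k a = r.
  elim: n => // n IH /=; have [Da|nDa] := pselect (D n a); last by rewrite asboolF.
  rewrite asboolT// add1n ltnS leq_eqVlt => /orP[/eqP ->|/IH//].
  by exists n.
exists (fun r => [set x | exists n, C n x /\ cnt n (g x) = r]); split.
- move=> r; apply: (sa_ex bor_sa) => n; apply: (sa_and bor_sa); first exact: bC.
  exact: (bg _ (bcnt n r)).
- by move=> x; rewrite CB; split => [[n Cn]|[r [n [Cn _]]]]; [exists (cnt n (g x)), n|exists n].
- by move=> r r' x [n [Cn <-]] [n' [Cn' <-]]; rewrite (dC _ _ _ Cn Cn').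
- move=> r x x' [n [Cn nr]] [n' [Cn' nr']] gg.
  have nn' : n = n'.
    case: (ltngtP n n') => // h; exfalso.
      have /(cntS _ _ _ h) : D n (g x) by exists x.
      by rewrite nr gg nr' ltnn.
    have /(cntS _ _ _ h) : D n' (g x') by exists x'.
    by rewrite nr' -gg nr ltnn.
  by subst n'; exact: iC Cn Cn' gg.
- move=> r x [n [Cn nr]]; have [|k [[y Cy gy] kr]] := @cntI n r (g x); first by rewrite nr.
  by exists y => //; exists k; rewrite gy.
Qed.

Lemma uncountable_baire K : bor K -> ~ countable K -> exists th : baire -> baire,
  [/\ borel_fun bor bor th, forall u u', K u -> K u' -> th u = th u' -> u = u' &
      forall y, exists2 u, K u & th u = y].
Proof.
move=> bK nK.
have sK := trace_embeds bK.
have sT : sborel bor by exists id; split => //;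
  [have := bor_setT; congr bor; apply/seteqP; split => // x _; exists x
  |apply/seteqP; split => [A bA|_ [A bA <-]//]; exists A].
have nK' : ~ countable (id @` K) by rewrite image_id.
have [c [_ cK ci]] := perfect_borel bK bf_id nK'.
have cKT : [set: {x | K x}] #= [set: baire].
  rewrite (card_eql (card_subspace K)) card_eq_le card_leT /=.
  by apply: (@card_le_inj _ _ _ _ c) => // x y _ _ /ci.
have [h bh [h' hh' h'h]] := borel_isomorphism (ex_intro _ _ sK) sT cKT.
have [th bth thP] := embeds_ext sK bh.
exists th; split => // [u u' Ku Ku'|y].
  rewrite -[u]/(sval (exist _ u Ku)) -[u']/(sval (exist _ u' Ku')) !thP.
  by move=> /(can_inj hh') ->.
exists (sval (h' y)); first exact: (proj2_sig (h' y)).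
by rewrite thP h'h.
Qed.

Lemma countable_Cplus (A : set Cplus) : countable A.
Proof. by apply/countable_injP; exists Cplus_code => m m' _ _ /Cplus_code_inj. Qed.

Lemma bor_countable (A : set baire) : countable A -> bor A.
Proof.
apply: (sa_countable bor_sa) => x.
exact: (bf_eq bor_sa bf_id (bf_cst bor_sa x)).
Qed.

(** The classes of size continuum are identified with the Baire space one by one; the points of the
    others are numbered by their rank. *)
Lemma countably_many_continuum_param (R : realType) (X : stdBorelType R)
  (E : X -> X -> Prop) (f : X -> baire) :
  borel_fun (@borel R X) bor f -> (forall x y, E x y <-> f x = f y) ->
  countable (classes_of_card E Ccontinuum) -> borel_parametrizable E.
Proof.
move=> bf fE cc; have [i iS] := borelT X; have [ii bi SE] := iS.
have [g bg gi] := embeds_ext iS bf; have SS := embeds_sa iS.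
pose K a := [set u | range i u /\ g u = a].
pose Ac := [set a | ~ countable (K a)].
have cAc : countable Ac.
  move: cc; rewrite (eq_countable (classes_fibres bf fE)); congr countable.
  by apply/seteqP; split => a /=; rewrite (eq_countable (fibre_extend iS gi a)).
have bAc : bor Ac by exact: bor_countable.
have bK a : bor (K a).
  by apply: (sa_and bor_sa) => //; exact: (bf_eq bor_sa bg (bf_cst bor_sa a)).
pose B' := [set u | range i u /\ ~ Ac (g u)].
have bB' : bor B'.
  by apply: (sa_and bor_sa) => //; apply: (sa_not bor_sa); exact: (bg _ bAc).
have [|G [bG BG dG iG GS]] := @countable_to_one_ranks B' g bB' bg.
  move=> a; have [Aa|/contrapT nAa] := pselect (Ac a).
    rewrite (_ : [set x | _] = set0); first exact: countable0.
    by rewrite -subset0 => u [[_ nA] ga]; apply: nA; rewrite ga.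
  by apply: sub_countable nAa; apply: subset_card_le => u [[? _] ?]; split.
have /choice[th thP] : forall a, exists th : baire -> baire, Ac a -> [/\ borel_fun bor bor th,
    forall u u', K a u -> K a u' -> th u = th u' -> u = u' & forall y, exists2 u, K a u & th u = y].
  move=> a; have [/(uncountable_baire (bK a))[th]|] := pselect (Ac a); first by exists th.
  by exists id.
(* [H r a] says that the fibre above [a] is countable and has more than [r] points. *)
pose H r := g @` G r.
have bH r : bor (H r).
  by have [|_ [_ _]] := @lusin_souslin (G r) g (bG r) bg; first exact: iG.
have Hmono r k a : H (r + k)%N a -> H r a.
  elim: k a => [|k IH] a; rewrite ?addn0 ?addnS// => -[x Gx <-].
  by have [y Gy <-] := GS _ _ Gx; apply: IH; exists y.
have Hle r r' a : (r <= r')%N -> H r' a -> H r a.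
  by move=> rr'; rewrite -(subnKC rr'); exact: Hmono.
have HAc r a : H r a -> ~ Ac a.
  move=> [u Gu <-]; have /BG[] : exists r, G r u by exists r.
  by [].
(* [Cfin n] stands for n+1 points, whose ranks are 0 to [n]. *)
pose ZS m := match m with
  | Cfin n => [set a | H n a /\ ~ H n.+1 a]
  | Caleph0 => [set a | forall n, H n a]
  | Ccontinuum => Ac end.
pose YS m := match m with
  | Cfin n => [set y : baire | exists2 k, (k < n.+1)%N & y = fun=> k]
  | Caleph0 => [set y : baire | exists k, y = fun=> k]
  | Ccontinuum => setT end.
have bZS m : bor (ZS m).
  case: m => [n||] //=.
  - by apply: (sa_and bor_sa); [exact: bH|exact: (sa_not bor_sa (bH _))].
  - by apply: (sa_all bor_sa) => n; exact: bH.
have YS0 k k' : (fun=> k) = (fun=> k') :> baire -> k = k' by move/(congr1 (@^~ 0%N)).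
have YScard m : has_card (YS m) m.
  case: m => [n||] /=; rewrite card_eq_sym.
  - apply: (@card_eq_bij _ _ _ _ (fun k _ => k)) => [k kn|k k' _ _ /YS0//|y [k kn ->]].
      by exists k.
    by exists k.
  - apply: (@card_eq_bij _ _ _ _ (fun k _ => k)) => [k kn|k k' _ _ /YS0//|y [k ->]].
      by exists k.
    by exists k.
  - by rewrite card_eq_sym; exact: card_baire.
have bYS m : bor (YS m).
  have := YScard m; case: m => [n||] //= h; last exact: bor_setT.
  - by apply: bor_countable; apply: finite_set_countable; exists n.+1.
  - by apply: bor_countable; rewrite (eq_countable h); exact: countableP.
have ZSu m m' a : ZS m a -> ZS m' a -> m = m'.
  case: m => [n||]; case: m' => [n'||] //=.
  - move=> [h nh] [h' nh']; case: (ltngtP n n') => [nn'|nn'|-> //].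
      by exfalso; apply: nh; exact: Hle nn' h'.
    by exfalso; apply: nh'; exact: Hle nn' h.
  - by move=> [_ nh] /(_ n.+1).
  - by move=> [/HAc].
  - by move=> + [_ nh] => /(_ n'.+1).
  - by move=> /(_ 0%N)/HAc.
  - by move=> + [/HAc].
  - by move=> + /(_ 0%N)/HAc.
pose Z m := borel_subspace R (bZS m); pose Y m := borel_subspace R (bYS m).
pose zval m (z : Z m) : baire := sval z.
pose yval m (y : Y m) : baire := sval y.
have zin m (z : Z m) : ZS m (zval m z) by exact: (proj2_sig z).
have yin m (y : Y m) : YS m (yval m y) by exact: (proj2_sig y).
(* The second coordinate of [phi]: the image under the isomorphism [th] of the class, or the rank as
   a constant sequence. *)
have /choice[et etP] : forall u, exists y : baire, (Ac (g u) -> y = th (g u) u) /\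
    (forall r, G r u -> y = fun=> r).
  move=> u; have [Au|nAu] := pselect (Ac (g u)).
    exists (th (g u) u); split => // r Gr.
    by case: (HAc r (g u)) => //; exists u.
  have [[r Gr]|nr] := pselect (exists r, G r u); last first.
    by exists id; split => // r Gr; case: nr; exists r.
  by exists (fun=> r); split => // r' Gr'; rewrite (dG _ _ _ Gr Gr').
have bet : borel_fun (@borel R X) bor (et \o i).
  apply: borel_funN => // n k.
  (* The maps [th a] are chosen independently; countability of [Ac] keeps their union Borel. *)
  apply: (@sa_ext _ (@borel R X) (fun x => G k (i x) \/
      exists2 a, Ac a & f x = a /\ th a (i x) n = k)).
    move=> x; split => [[/(etP (i x)).2 /= ->//|[a Aa [xa <-]]]|/= <-].
      by have [h _] := etP (i x); rewrite /= h gi xa.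
    have [Ax|nAx] := pselect (Ac (f x)).
      right; exists (f x) => //; split => //.
      by have [h _] := etP (i x); rewrite /= h gi.
    have /BG[r Gr] : B' (i x) by split; [exists x|rewrite gi].
    by left; have [_ /(_ r Gr) ->] := etP (i x).
  apply: (sa_or SS); first exact: (embeds_bf iS (bG k)).
  apply: (sa_ex_countable SS cAc) => a Aa; apply: (sa_and SS).
    exact: (bf_eq SS bf (bf_cst SS a)).
  have [bth _ _] := thP a Aa.
  exact: (bfN n k (borel_fun_comp (embeds_bf iS) bth)).
have /choice[phi phiP] : forall x, exists p : {m : Cplus & (Z m * Y m)%type},
    zval _ (projT2 p).1 = f x /\ yval _ (projT2 p).2 = et (i x).
  move=> x.
  have [m [mz my]] : exists m, ZS m (f x) /\ YS m (et (i x)); last first.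
    by exists (existT (fun m => (Z m * Y m)%type) m (exist _ _ mz, exist _ _ my)).
  have [Ax|nAx] := pselect (Ac (f x)); first by exists Ccontinuum.
  have /BG[r Gr] : B' (i x) by split; [exists x|rewrite gi].
  have Hr : H r (f x) by exists (i x); rewrite ?gi.
  have [_ /(_ r Gr) ->] := etP (i x).
  have [Hall|nH] := pselect (forall n, H n (f x)); first by exists Caleph0; split => //; exists r.
  have ex : exists n, ~~ `[< H n (f x) >].
    by apply: contrapT => /forallNP h; apply: nH => n; have /negP := h n; rewrite negbK => /asboolP.
  case: (ex_minnP ex) => -[|n] /asboolPn nHn nmin.
    by case: nHn; exact: Hle Hr.
  exists (Cfin n); split.
    split => //; apply: contrapT => nHn'.
    by have := nmin n; rewrite ltnn => h; have := h (introN (asboolP _) nHn').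
  exists r => //; rewrite ltnNge; apply/negP => nr; apply: nHn; exact: Hle nr Hr.
have phi_eq m (z : Z m) (y : Y m) x : zval m z = f x -> yval m y = et (i x) -> phi x = existT _ m (z, y).
  move=> zx yx; have [] := phiP x; case: (phi x) => m' [z' y'] /= zx' yx'.
  have e : m = m' by apply: (ZSu _ _ (f x)); [rewrite -zx|rewrite -zx']; exact: zin.
  subst m'; have -> : z' = z by apply: sig_inj; rewrite -/(zval m z') zx' -zx.
  by have -> : y' = y by apply: sig_inj; rewrite -/(yval m y') yx' -yx.
exists Z, Y, phi; split.
- by move=> m; apply: has_card_eq (YScard m); rewrite card_eq_sym; exact: card_subspace.
(* Every Borel set of the product is a preimage under the pairing of codes, which reduces Borelness
   of [phi] to that of [f] and [et]. *)
- have prodB m (A : set (Z m * Y m)) : prod_borel (@borel R (Z m)) (@borel R (Y m)) A ->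
      exists B, bor B /\ A = [set p | B (pairN (zval m p.1) (yval m p.2))].
    pose S' := [set (fun p : Z m * Y m => pairN (zval m p.1) (yval m p.2)) @^-1` B | B in bor].
    suff : prod_borel (@borel R (Z m)) (@borel R (Y m)) `<=` S'.
      by move=> /[apply] -[B bB <-]; exists B.
    apply: smallest_sub; first exact: (sa_preimage _ bor_sa).
    move=> _ [_ [A1 bA1 <-] [_ [A2 bA2 <-] <-]].
    exists [set w | A1 (pr0 w) /\ A2 (pr1 w)].
      by apply: (sa_and bor_sa); [exact: (bf_pr0 bor_sa bf_id bA1)|exact: (bf_pr1 bor_sa bf_id bA2)].
    by apply/seteqP; split => p /=; rewrite pr0_pair pr1_pair.
  move=> A SA; have /choice[Bm BmP] := fun m => prodB m _ (SA m).
  apply: (@sa_ext _ (@borel R X) (fun x => exists2 m, setT m & ZS m (f x) /\ Bm m (pairN (f x) (et (i x)))) (phi @^-1` A)).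
    move=> x; rewrite /preimage /mkset; have [] := phiP x; case: (phi x) => m [z y] /= zx yx.
    have [_ AE] := BmP m.
    have AB : A (existT _ m (z, y)) <-> Bm m (pairN (f x) (et (i x))).
      by rewrite -zx -yx; have := congr1 (@^~ (z, y)) AE => /= <-.
    split => [[m' _ [mz]]|/AB h]; last by exists m => //; split => //; rewrite -zx; exact: zin.
    by rewrite (ZSu m' m (f x)) ?AB// -zx; exact: zin.
  apply: (sa_ex_countable SS (countable_Cplus _)) => m _; apply: (sa_and SS).
    exact: (bf _ (bZS m)).
  exact: (bf_pair SS bf bet (BmP m).1).
- apply: bijective_of => [x x' xx'|[m [z y]]].
    have [fx ex] := phiP x; have [fx' ex'] := phiP x'.
    have ff : f x = f x' by rewrite -fx -fx' xx'.
    have ee : et (i x) = et (i x') by rewrite -ex -ex' xx'.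
    apply: ii; have [Ax|nAx] := pselect (Ac (f x)).
      have [_ thi _] := thP _ Ax; apply: thi.
      + by split; [exists x|rewrite gi].
      + by split; [exists x'|rewrite gi ff].
      + have [h1 _] := etP (i x); have [h2 _] := etP (i x').
        by move: ee; rewrite h1 ?h2 ?gi -?ff.
    have /BG[r Gr] : B' (i x) by split; [exists x|rewrite gi].
    have /BG[r' Gr'] : B' (i x') by split; [exists x'|rewrite gi -ff].
    have [_ /(_ _ Gr) h1] := etP (i x); have [_ /(_ _ Gr') h2] := etP (i x').
    have /YS0 e : (fun=> r) = (fun=> r') :> baire by rewrite -h1 -h2.
    by subst r'; apply: iG Gr Gr' _; rewrite !gi.
  have zz := zin m z; have yy := yin m y.
  have [x [zx yx]] : exists x, zval m z = f x /\ yval m y = et (i x); last first.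
    by exists x; exact: phi_eq.
  have Hcase k : H k (zval m z) -> yval m y = (fun=> k) ->
      exists x, zval m z = f x /\ yval m y = et (i x).
    move=> [u Gu gu] ->; have [[x _ xu] _] : B' u by apply/BG; exists k.
    subst u; exists x; rewrite -gu gi; split => //.
    by have [_ /(_ k Gu) ->] := etP (i x).
  case: m z y zz yy Hcase => [n||] z y /= zz yy Hcase.
  + by have [k kn yk] := yy; apply: (Hcase k) => //; apply: (Hle _ n) => //; case: zz.
  + by have [k yk] := yy; apply: (Hcase k).
  + have [_ _ /(_ (yval _ y))[u [[x _ xu] gu] thu]] := thP _ zz.
    subst u; exists x; rewrite -gi gu; split => //.
    by have [h _] := etP (i x); rewrite h gu.
- move=> x y; rewrite fE; have [fx ex] := phiP x; have [fy ey] := phiP y.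
  split => [ff|e]; last first.
    have := congr1 (fun p : {m : Cplus & Z m} => zval _ (projT2 p)) e.
    by rewrite /dunion_pi1 /= fx fy.
  move: fx fy; case: (phi x) => m [z w]; case: (phi y) => m' [z' w'] /= fx fy.
  have e : m = m' by apply: (ZSu _ _ (f x)); [rewrite -fx|rewrite ff -fy]; exact: zin.
  subst m'; rewrite /dunion_pi1 /=.
  by have -> : z = z' by apply: sig_inj; rewrite -/(zval m z) fx ff -fy.
Qed.

(** * Relations with standard and with nonstandard quotient *)

Section StandardQuotient.
Variable R : realType.

(** The range of a reduction stands for the quotient; to refute the property, all reductions have to
    be considered. *)
Definition standard_quotient (X : stdBorelType R) (E : X -> X -> Prop) :=
  exists f : X -> baire, [/\ borel_fun (@borel R X) bor f,
    forall x y, E x y <-> f x = f y & bor (range f)].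

Lemma standard_quotient_iso (X Y : stdBorelType R) (E : X -> X -> Prop) (F : Y -> Y -> Prop) :
  borel_isomorphic E F -> standard_quotient F -> standard_quotient E.
Proof.
move=> [h [bh [k hk kh] hEF]] [f [bf fF bfr]]; exists (f \o h); split.
- exact: borel_fun_comp bh bf.
- by move=> x y; rewrite hEF fF.
- move: bfr; congr bor; apply/seteqP; split => _ [y _ <-]; last by exists (h y).
  by exists (k y) => //=; rewrite kh.
Qed.

Lemma borel_isomorphic_sym (X Y : stdBorelType R) (E : X -> X -> Prop) (F : Y -> Y -> Prop) :
  borel_isomorphic E F -> borel_isomorphic F E.
Proof.
move=> [h [bh [k hk kh] hEF]]; exists k; split; last by move=> x y; rewrite hEF !kh.
- move=> A SA; have [i iS] := borelT X; have [j jS] := borelT Y; have [ji _ _] := jS.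
  have : @borel R Y (h @` A).
    by apply: (borel_image iS (embeds_bf jS) ji bh SA) => x y _ _ /(can_inj hk).
  congr borel; apply/seteqP; split => [_ [x Ax <-]|y Ay]; first by rewrite /preimage /= hk.
  by exists (k y).
- by exists h.
Qed.

(* The new relation spreads a copy of the class of [x] above each point [x] of
   [V]; [V] is a transversal of the classes whose cardinality occurs countably
   often and contains all other points, where repeating each class as many
   times as it has points does not change the number of classes. *)
Lemma standard_quotient_same_shape (X : stdBorelType R) (E : X -> X -> Prop) (f : X -> baire) :
  borel_fun (@borel R X) bor f -> (forall x y, E x y <-> f x = f y) ->
  exists (Y : stdBorelType R) (F : Y -> Y -> Prop),
    [/\ borel_equivalence F, smooth F, same_fine_shape E F & standard_quotient F].
Proof.
move=> bf fE; have [i iS] := borelT X; have [ii bi SE] := iS.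
have [g bg gi] := embeds_ext iS bf; have SS := embeds_sa iS.
pose cls x := [set y | E x y].
have clsE x : cls x = [set y | f y = f x] by exact: classE.
have clsx x : cls x x by apply/fE.
have cls_eq x y : f x = f y -> cls x = cls y by rewrite !clsE => ->.
have cls_inj x y : cls x = cls y -> f x = f y.
  by move=> h; have := clsx x; rewrite h => /fE ->.
(* A representative in each fibre; [None] is for the empty ones. *)
have /choice[pick pickP] : forall a, exists o : option X,
    if o is Some y then f y = a else forall y, f y <> a.
  move=> a; have [[y ya]|na] := pselect (exists y, f y = a); first by exists (Some y).
  by exists None => y ya; apply: na; exists y.
have pickx x : exists2 y, pick (f x) = Some y & f y = f x.
  by have := pickP (f x); case: (pick (f x)) => [y|/(_ x)//]; exists y.
pose M m := countable (classes_of_card E m).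
pose XM x := exists m, M m /\ has_card (cls x) m.
pose TM := [set x | XM x /\ pick (f x) = Some x].
(* [Cplus] being countable, so are these representatives, and an arbitrary choice of them forms a
   Borel set. *)
have cTM : countable TM.
  have : countable (\bigcup_(m in M) classes_of_card E m).
    by apply: bigcup_countable; [exact: countable_Cplus|].
  apply: sub_countable; apply: (@card_le_inj _ _ _ _ cls).
    by move=> x [[m [Mm hm]] _]; exists m => //; split => //; exists x.
  by move=> x y [_ px] [_ py] /cls_inj e; move: px; rewrite e py => -[].
have SXM : @borel R X [set x | XM x].
  apply: (@sa_ext _ (@borel R X) (fun x => exists2 t, TM t & f x = f t)).
    move=> x; split => [[t [[m [Mm hm]] _] xt]|[m [Mm hm]]].
      by exists m; split => //; rewrite (cls_eq _ _ xt).
    have [y py yx] := pickx x; exists y => //; split; last by rewrite yx.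
    by exists m; split => //; rewrite (cls_eq _ _ yx).
  apply: (sa_ex_countable SS cTM) => t _.
  exact: (bf_eq SS bf (bf_cst SS (f t))).
pose V := [set x | ~ XM x \/ TM x].
have SV : @borel R X V.
  apply: (sa_or SS); first exact: (sa_not SS SXM).
  exact: (sborel_countable iS cTM).
(* Pairs of a point of [V] and a point of its class. The first component is the reduction of [F],
   and its range is the Borel image of [V] under [i]. *)
pose W := [set w | (i @` V) (pr0 w) /\ (range i (pr1 w) /\ g (pr0 w) = g (pr1 w))].
have b0 : borel_fun bor bor pr0 by exact: (bf_pr0 bor_sa bf_id).
have b1 : borel_fun bor bor pr1 by exact: (bf_pr1 bor_sa bf_id).
have bW : bor W.
  apply: (sa_and bor_sa); first exact: (b0 _ (embeds_image iS SV)).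
  apply: (sa_and bor_sa); first exact: (b1 _ bi).
  exact: (bf_eq bor_sa (borel_fun_comp b0 bg) (borel_fun_comp b1 bg)).
pose Y := borel_subspace R bW.
pose q (w : Y) : baire := pr0 (sval w).
pose F (w w' : Y) := q w = q w'.
have bq : borel_fun (@borel R Y) bor q.
  by move=> B /b0 bB; exists (pr0 @^-1` B).
have FE w w' : F w w' <-> q w = q w' by [].
have mk x y : V x -> f x = f y -> W (pairN (i x) (i y)).
  move=> Vx xy; split; rewrite ?pr0_pair ?pr1_pair; first by exists x.
  by split; [exists y|rewrite !gi].
have wV (w : Y) : exists2 x, V x & q w = i x.
  by have [[x Vx xw] _] := proj2_sig w; exists x.
have /choice[yy yyP] : forall w : Y, exists y, i y = pr1 (sval w).
  by move=> w; have [_ [[y _ yw] _]] := proj2_sig w; exists y.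
exists Y, F; split.
- exact: (reducible_borel bq FE).
- exact: (reducible_smooth bq FE).
- move=> m; rewrite card_eq_sym.
  (* The classes of [F] are the sets [Fc x], one for each [x] in [V] and of the same size as the
     class of [x]. *)
  pose Vm := [set x | V x /\ has_card (cls x) m].
  pose Fc x := [set w : Y | q w = i x].
  have Fcard x : V x -> Fc x #= cls x.
    move=> Vx; apply: (@card_eq_bij _ _ _ _ yy).
    + move=> w qw; apply/fE; have [_ [_ gw]] := proj2_sig w.
      by rewrite -!gi yyP -gw -/(q w) qw.
    + move=> w w' qw qw' yw; apply: sig_inj.
      rewrite -(pair_pr (sval w)) -(pair_pr (sval w')) -!yyP yw; congr pairN.
      by rewrite -/(q w) -/(q w') qw qw'.
    + move=> y /fE xy; exists (exist _ _ (mk x y Vx xy)); first by rewrite /Fc /q /= pr0_pair.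
      by apply: ii; rewrite yyP /= pr1_pair.
  have FVm : Vm #= classes_of_card F m.
    apply: (@card_eq_bij _ _ _ _ Fc) => [x [Vx hx]|x x' [Vx _] [Vx' _] xx'|C [[w ->] hC]].
    + split; last by apply: has_card_eq hx; rewrite card_eq_sym; exact: Fcard.
      exists (exist _ _ (mk x x Vx erefl)); apply/seteqP.
      by split => w; rewrite /Fc /F /q /= pr0_pair.
    + have : Fc x (exist _ _ (mk x x Vx erefl)) by rewrite /Fc /q /= pr0_pair.
      by rewrite xx' /Fc /q /= pr0_pair => /ii.
    + have [x Vx xw] := wV w.
      have FcE : Fc x = [set w' | F w w'].
        by apply/seteqP; split => w'; rewrite /Fc /F /= xw.
      exists x => //; split => //; apply: has_card_eq hC; rewrite -FcE.
      exact: Fcard.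
  rewrite card_eq_sym in FVm; rewrite (card_eql FVm).
  have [Mm|nMm] := pselect (M m).
    apply: (@card_eq_bij _ _ _ _ cls).
    + by move=> x [_ hx]; split => //; exists x.
    + move=> x x' [Vx hx] [Vx' hx'] /cls_inj e.
      have [nX|[_ px]] := Vx; first by case: nX; exists m.
      have [nX|[_ px']] := Vx'; first by case: nX; exists m.
      by move: px; rewrite e px' => -[].
    + move=> C [[x ->] hC]; have [y py yx] := pickx x; have e := cls_eq _ _ yx.
      exists y => //; split; last by rewrite e.
      by right; split; [exists m; rewrite e|rewrite yx].
  have VmE x : has_card (cls x) m -> Vm x.
    move=> hx; split => //; left => -[m' [Mm' hm']]; apply: nMm.
    by rewrite (has_card_uniq hx hm').
  rewrite card_eq_le; apply/andP; split; last first.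
    have -> : classes_of_card E m = cls @` Vm.
      apply/seteqP; split => [C [[x ->] hC]|_ [x [_ hx] <-]]; last by split => //; exists x.
      by exists x => //; exact: VmE.
    exact: card_image_le.
  have [mc|mc] := pselect (m = Ccontinuum).
    (* [E] has continuum many such classes, and [X] has no more points than that. *)
    subst m; rewrite (card_le_eqr (continuum_classes bf fE nMm)) -(card_le_eqr card_baire).
    by apply: (@card_le_inj _ _ _ _ i) => // x y _ _ /ii.
  have inf : infinite_set (classes_of_card E m) by move=> /finite_set_countable.
  (* A class is repeated once for each of its countably many points, hence the factor [nat]. *)
  apply: card_le_trans (infinite_setX_nat inf).
  have /choice[idx idxP] : forall C : set X, exists h : X -> nat, countable C ->
      {in C &, injective h}.
    move=> C; have [/countable_injP[h hi]|] := pselect (countable C); first by exists h.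
    by exists (fun=> 0%N).
  apply: (@card_le_inj _ _ _ _ (fun x => (cls x, idx (cls x) x))) => [x [_ hx]|x y [_ hx] _ [exy]].
    by split => //; exists x.
  have ccls : countable (cls x).
    case: m mc hx {inf nMm VmE FVm Vm} => [n||] //= _ hx.
      by apply: finite_set_countable; exists n.+1.
    by rewrite (eq_countable hx); exact: countableP.
  rewrite -exy; apply: (idxP _ ccls); rewrite ?inE; first exact: clsx.
  by rewrite exy; exact: clsx.
- exists q; split => //; have := embeds_image iS SV; congr bor.
  apply/seteqP; split => [_ [x Vx <-]|_ [w _ <-]].
    by exists (exist _ _ (mk x x Vx erefl)); rewrite // /q /= pr0_pair.
  by have [x Vx ->] := wV w; exists x.
Qed.

(* Add to [E] a relation whose classes all have cardinality the continuum and
   whose quotient is an analytic non-Borel set. *)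
Lemma nonstandard_quotient_same_shape (X : stdBorelType R) (E : X -> X -> Prop) (f : X -> baire) :
  borel_fun (@borel R X) bor f -> (forall x y, E x y <-> f x = f y) ->
  ~ countable (classes_of_card E Ccontinuum) ->
  exists (Y : stdBorelType R) (F : Y -> Y -> Prop),
    [/\ borel_equivalence F, smooth F, same_fine_shape E F & ~ standard_quotient F].
Proof.
move=> bf fE nc; have [i iS] := borelT X; have [ii bi SE] := iS.
have [g bg gi] := embeds_ext iS bf; have SS := embeds_sa iS.
have [D [bD nbD]] := nonborel_projection.
pose c0 : baire := fun=> 0%N; pose c1 : baire := fun=> 1%N.
have c01 : c0 <> c1 by move/(congr1 (@^~ 0%N)).
have b0 : borel_fun bor bor pr0 by exact: (bf_pr0 bor_sa bf_id).
have b1 : borel_fun bor bor pr1 by exact: (bf_pr1 bor_sa bf_id).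
(* The tag [c0] marks the points of [X], the tag [c1] the pairs of a point of [D] and a free
   parameter; the latter makes the added classes large. *)
pose W0 := [set w | pr0 w = c0 /\ range i (pr1 w)].
pose W1 := [set w | pr0 w = c1 /\ D (pr0 (pr1 w))].
have bW0 : bor W0.
  by apply: (sa_and bor_sa); [exact: (bf_eq bor_sa b0 (bf_cst bor_sa c0))|exact: (b1 _ bi)].
have bW1 : bor W1.
  apply: (sa_and bor_sa); first exact: (bf_eq bor_sa b0 (bf_cst bor_sa c1)).
  exact: (b1 _ (b0 _ bD)).
pose W := [set w | W0 w \/ W1 w].
have bW : bor W by exact: (sa_or bor_sa).
(* The index of the class of an added point, ranging over the non-Borel projection of [D]. *)
pose al (w : baire) : baire := pr0 (pr0 (pr1 w)).
have bal : borel_fun bor bor al by exact: (borel_fun_comp b1 (borel_fun_comp b0 b0)).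
pose fF w := pairN (pr0 w) (if pr0 w 0%N == 0%N then g (pr1 w) else al w).
have bfF : borel_fun bor bor fF.
  apply: borel_funN => // n k.
  apply: (@sa_ext _ bor (fun w => (pr0 w 0%N = 0%N /\ pairN (pr0 w) (g (pr1 w)) n = k) \/
      (pr0 w 0%N <> 0%N /\ pairN (pr0 w) (al w) n = k))).
    move=> w; rewrite /fF; have [e|/eqP e] := eqVneq (pr0 w 0%N) 0%N; split => //.
    - by case=> [[]//|[/(_ e)]].
    - by left.
    - by case=> [[/e]|[]].
    - by right.
  apply: (sa_or bor_sa); apply: (sa_and bor_sa).
  - exact: (bfN 0%N 0%N b0).
  - exact: (bfN n k (bf_pair bor_sa b0 (borel_fun_comp b1 bg))).
  - exact: (bf_coord bor_sa 0%N (fun x => x <> 0%N) b0).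
  - exact: (bfN n k (bf_pair bor_sa b0 bal)).
have fF0 w : pr0 w = c0 -> fF w = pairN c0 (g (pr1 w)) by rewrite /fF => ->.
have fF1 w : pr0 w = c1 -> fF w = pairN c1 (al w) by rewrite /fF => ->.
have fFpr0 w : pr0 (fF w) = pr0 w by rewrite /fF pr0_pair.
pose Y := borel_subspace R bW.
have sY := trace_embeds bW.
pose q (w : Y) : baire := fF (sval w).
pose F (w w' : Y) := q w = q w'.
have bq : borel_fun (@borel R Y) bor q.
  by move=> B /bfF bB; exists (fF @^-1` B).
have FE w w' : F w w' <-> q w = q w' by [].
have Win x : W (pairN c0 (i x)).
  by left; split; rewrite ?pr0_pair ?pr1_pair//; exists x.
pose in0 x : Y := exist _ _ (Win x).
have in0i : injective in0.
  by move=> x y /(congr1 (fun w : Y => pr1 (sval w))); rewrite /= !pr1_pair => /ii.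
have q0 x : q (in0 x) = pairN c0 (f x) by rewrite /q fF0 /= ?pr0_pair// pr1_pair gi.
have cl0 x : [set w | F (in0 x) w] = in0 @` [set y | E x y].
  apply/seteqP; split => [w|_ [y /fE xy <-]]; last by rewrite /F /= !q0 xy.
  rewrite /F /= => e; have pw : pr0 (sval w) = c0.
    by rewrite -fFpr0 -/(q w) -e q0 pr0_pair.
  have [[_ [y _ yw]]|[pw1 _]] := proj2_sig w; last by case: c01; rewrite -pw -pw1.
  exists y; last by apply: sig_inj; rewrite /= yw -pw pair_pr.
  apply/fE; move: e; rewrite q0 /q fF0// -yw gi => /(congr1 pr1).
  by rewrite !pr1_pair.
have cl0card x m : has_card [set w | F (in0 x) w] m <-> has_card [set y | E x y] m.
  have e : in0 @` [set y | E x y] #= [set y | E x y] by apply: inj_card_eq => y z _ _ /in0i.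
  by rewrite cl0; split; apply: has_card_eq => //; rewrite card_eq_sym.
have cl1 (w : Y) : W1 (sval w) -> has_card [set w' | F w w'] Ccontinuum.
  move=> [pw Dw]; apply: uncountable_card_continuum.
    by rewrite (classE FE); exact: (class_borel bq).
  have Wt t : W (pairN c1 (pairN (pr0 (pr1 (sval w))) t)).
    by right; split; rewrite ?pr0_pair ?pr1_pair ?pr0_pair.
  apply: contra_not uncountable_cantor; rewrite -(eq_countable card_baire).
  apply: sub_countable; apply: (@card_le_inj _ _ _ _ (fun t => exist _ _ (Wt t) : Y)).
    move=> t _; rewrite /F /q /= (fF1 _ pw) fF1 ?pr0_pair//.
    by rewrite /al pr1_pair pr0_pair.
  move=> t t' _ _ /(congr1 (fun w : Y => pr1 (pr1 (sval w)))).
  by rewrite /= !pr1_pair.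
exists Y, F; split.
- exact: (reducible_borel bq FE).
- exact: (reducible_smooth bq FE).
- move=> m.
  have im C : classes_of_card E m C -> classes_of_card F m (in0 @` C).
    by move=> [[x ->] hC]; rewrite -cl0; split; [exists (in0 x)|apply/cl0card].
  have imi (C C' : set X) : in0 @` C = in0 @` C' -> C = C'.
    have sub (A A' : set X) : in0 @` A = in0 @` A' -> A `<=` A'.
      move=> AA' x Ax; have : (in0 @` A) (in0 x) by exists x.
      by rewrite AA' => -[y Ay /in0i <-].
    by move=> e; apply/seteqP; split; apply: sub.
  have [mc|mc] := pselect (m = Ccontinuum).
    subst m; have e := continuum_classes bf fE nc.
    rewrite card_eq_le; apply/andP; split.
      by apply: (@card_le_inj _ _ _ _ (fun C => in0 @` C)) => // C C' _ _ /imi.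
    by rewrite (card_le_eqr e); exact: (classes_le FE).
  apply: (@card_eq_bij _ _ _ _ (fun C => in0 @` C)) => // [C C' _ _ /imi//|C [[w ->] hC]].
  have [[pw [x _ xw]]|w1] := proj2_sig w; last first.
    by case: mc; exact: (has_card_uniq hC (cl1 w w1)).
  have we : w = in0 x by apply: sig_inj; rewrite /= xw -pw pair_pr.
  subst w; exists [set y | E x y]; last by rewrite cl0.
  by split; [exists x|apply/cl0card].
(* If [p] is a reduction with Borel range, the image of [W1] is Borel, since inside that range it
   can be separated from the image of [W0]. On it, [al] is a Borel injective function [h] of the
   value of [p], so by Lusin-Souslin the projection of [D] would be Borel. *)
- move=> [p [bp pF bpr]].
  have [p' bp' pp'] := embeds_ext sY bp.
  have pE w w' : W w -> W w' -> p' w = p' w' -> fF w = fF w'.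
    move=> Ww Ww'; rewrite -[w]/(sval (exist _ w Ww)) -[w']/(sval (exist _ w' Ww')) !pp'.
    by move/pF.
  have alE w w' : W1 w -> W1 w' -> p' w = p' w' -> al w = al w'.
    move=> w1 w1' /pE; case: (w1) (w1') => pw _ [pw' _].
    rewrite (fF1 _ pw) (fF1 _ pw') => h.
    by have := congr1 pr1 (h (or_intror w1) (or_intror w1')); rewrite !pr1_pair.
  have pal w w' : W1 w -> W1 w' -> al w = al w' -> p' w = p' w'.
    move=> w1 w1' e.
    have : F (exist _ w (or_intror w1)) (exist _ w' (or_intror w1')).
      by rewrite /F /q /= (fF1 _ w1.1) (fF1 _ w1'.1) e.
    by move/pF; rewrite -!pp'.
  have [|D1 [bD1 D11 D10]] := @separation W1 W0 p' p' bW1 bW0 bp' bp'.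
    move=> w w' w1 w0 /(pE _ _ (or_intror w1) (or_introl w0)) /(congr1 pr0).
    by rewrite !fFpr0 w1.1 w0.1 => /esym.
  pose B1 := [set b | range p b /\ D1 b].
  have bB1 : bor B1 by exact: (sa_and bor_sa).
  have B1E : B1 = p' @` W1.
    apply/seteqP; split => [_ [[w _ <-] D1w]|_ [w w1 <-]]; last first.
      split; last exact: D11.
      by exists (exist _ w (or_intror w1)) => //; rewrite -pp'.
    have [w0|w1] := proj2_sig w; last by exists (sval w) => //; rewrite pp'.
    by case: (D10 _ w0); rewrite pp'.
  (* As in [lusin_souslin], [h] is decoded from sets separating the images according to coordinate
     [n] of [al]. *)
  have /choice[Dn DnP] : forall nk : nat * nat, exists D', [/\ bor D',
      forall w, W1 w -> al w nk.1 = nk.2 -> D' (p' w) &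
      forall w, W1 w -> al w nk.1 <> nk.2 -> ~ D' (p' w)].
    move=> [n k] /=.
    have [|||D' [bD' h1 h2]] := @separation [set w | W1 w /\ al w n = k] [set w | W1 w /\ al w n <> k] p' p' _ _ bp' bp'.
    + by apply: (sa_and bor_sa) => //; exact: (bfN _ _ bal).
    + by apply: (sa_and bor_sa) => //; apply: (sa_not bor_sa); exact: (bfN _ _ bal).
    + by move=> w w' [w1 wn] [w1' wn'] /(alE _ _ w1 w1') e; apply: wn'; rewrite -e.
    + by exists D'; split => // w w1 wn; [exact: h1|exact: h2].
  have [|h [bh hP]] := @bf_least _ _ bor_sa (fun n k => Dn (n, k)).
    by move=> n k; case: (DnP (n, k)).
  have hal w : W1 w -> h (p' w) = al w.
    move=> w1; apply/funext => n; apply: contrapT => ne.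
    have [_ _ /(_ w w1)] := DnP (n, h (p' w) n); apply; first by move=> /= e; apply: ne.
    by apply: hP; exists (al w n); have [_ + _] := DnP (n, al w n); apply.
  apply: nbD.
  have [|_ [_ _]] := @lusin_souslin B1 h bB1 bh.
    rewrite B1E => _ _ [w w1 <-] [w' w1' <-]; rewrite !hal//; exact: pal.
  rewrite B1E; congr bor; apply/seteqP; split => [_ [_ [w w1 <-] <-]|_ [d Dd <-]].
    by rewrite hal//; exists (pr0 (pr1 w)) => //; exact: w1.2.
  have w1 : W1 (pairN c1 (pairN d c0)) by split; rewrite ?pr0_pair ?pr1_pair ?pr0_pair.
  exists (p' (pairN c1 (pairN d c0))); first by exists (pairN c1 (pairN d c0)).
  by rewrite hal// /al pr1_pair pr0_pair.
Qed.

End StandardQuotient.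

Theorem theorem3p8 (R : realType) :
  (forall (X Y : stdBorelType R) (E : X -> X -> Prop) (F : Y -> Y -> Prop),
      borel_equivalence E -> borel_equivalence F ->
      borel_parametrizable E -> borel_parametrizable F ->
      (borel_isomorphic E F <-> same_fine_shape E F)) /\
  (forall (X : stdBorelType R) (E : X -> X -> Prop),
      borel_equivalence E -> smooth E -> ~ borel_parametrizable E ->
      exists (Y : stdBorelType R) (F : Y -> Y -> Prop),
        [/\ borel_equivalence F, smooth F, same_fine_shape E F &
            ~ borel_isomorphic E F]).
Proof.
split => [X Y E F _ _ pE pF|X E _ /smooth_reduction[f [bf fE]] nE].
  by split; [exact: iso_same_shape|exact: same_shape_iso].
have [sE|nsE] := pselect (standard_quotient E).
  have [|Y [F [bF sF EF nF]]] := nonstandard_quotient_same_shape bf fE.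
    by apply: contra_not nE; exact: countably_many_continuum_param bf fE.
  exists Y, F; split => // /borel_isomorphic_sym iso.
  by apply: nF; exact: standard_quotient_iso iso sE.
have [Y [F [bF sF EF qF]]] := standard_quotient_same_shape bf fE.
by exists Y, F; split => // iso; apply: nsE; exact: standard_quotient_iso iso qF.
Qed.
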